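(* Let $\Omega$ be a bounded rectangle in $\mathbb{R}^p$ with Lebesgue measure $\mu$, and let $Q^{(k)}$ be the random probability measures produced by the random recursive partitioning process with optional stopping described in the context, with stopping rule $\rho$, selection probabilities $\lambda_j(A)$ and assignment weights $\alpha_i^j(A)$. Suppose there is a $\delta>0$ such that, with probability $1$, $1-\delta>\rho(A)>\delta$ for any region $A$ generated during any step of the process. Suppose also that the selection probabilities $\lambda_j(A)$ and the assignment probabilities $\alpha_i^j(A)/\bigl(\sum_l\alpha_l^j(A)\bigr)$, for all $i,j$ and all elementary regions $A$, are uniformly bounded away from $0$ and $1$. Let $Q$ be the almost sure limit of $Q^{(k)}$ in variational distance (the optional Pólya tree) and let $q=dQ/d\mu$. Then for any probability density $f$ on $\Omega$ (with respect to $\mu$) and any $\tau>0$, $$P\left(\int|q(x)-f(x)|\,d\mu<\tau\right)>0.$$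
   Context: **Partitioning scheme.** $\Omega$ itself is regarded as the elementary region of level $0$. Every elementary region $A$ of level $k\ge 0$ is equipped with a finite number $M(A)\ge 1$ of ways to partition it: for $j=1,\ldots,M(A)$, $A=\bigcup_{l=1}^{K^j(A)}A_l^j$, a finite disjoint union. The sets $A_l^j$ so obtained are elementary regions of level $k+1$. All elementary regions are measurable with positive $\mu$-measure. $\mathcal{A}^k$ denotes the set of all possible level-$k$ elementary regions, $\mathcal{A}^{(k)}=\bigcup_{l=1}^k\mathcal{A}^l$. It is assumed that for every open $B\subset\Omega$ there exist $B_n\uparrow B$ where each $B_n$ is a finite union of disjoint regions in $\mathcal{A}^{(n)}$. **Parameters.** For each elementary region $A$: a nonrandom selection probability vector $\boldsymbol\lambda(A)=(\lambda_1,\ldots,\lambda_{M(A)})$ with $\lambda_j\ge 0$, $\sum_j\lambda_j=1$; and, for each $j\le M(A)$, a nonrandom assignment weight vector $\boldsymbol\alpha^j(A)=(\alpha_1^j,\ldots,\alpha^j_{K^j(A)})$ with positive entries. There is also a stopping rule $\rho$, which gives a stopping probability $\rho(A)\in[0,1]$ as specified below. **Random recursive partitioning with optional stopping.** Start with $T_0^0=\emptyset$, $T_1^0=\Omega$ and $Q^{(0)}$ the uniform distribution on $\Omega$. After $k$ steps one has $\Omega=T_0^k\cup T_1^k$ (disjoint), where $T_0^k$ (the stopped part) is a disjoint union of stopped elementary regions of level at most $k-1$, and $T_1^k$ (the continuing part) is a disjoint union of regions in $\mathcal{A}^k$ (for $k=0$, the single region $\Omega$); and a random probability measure $Q^{(k)}$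 which is uniformly distributed (with respect to $\mu$) within each region of these decompositions. Let $\mathcal{F}^{(k)}$ be the $\sigma$-field generated by all random variables used in the first $k$ steps. In step $k+1$, for each region $A$ in the decomposition of $T_1^k$, with independent draws (given $\mathcal F^{(k)}$) for the different regions and variables: - Draw $S\sim\mathrm{Bernoulli}(\rho(A))$, where $\rho(A)$ is required to be $\mathcal{F}^{(k)}$-measurable. If $S=1$, stop further partitioning of $A$ and add it to the set of stopped regions. - If $S=0$, draw $J\in\{1,\ldots,M(A)\}$ with $P(J=j)=\lambda_j(A)$. If $J=j$, partition $A=\bigcup_{l}A_l^j$ in the $j$th way and set $Q^{(k+1)}(A_l^j)=Q^{(k)}(A)\,\theta_l^j$, where $\boldsymbol\theta^j=(\theta^j_1,\ldots,\theta^j_{K^j(A)})$ is drawn from the Dirichlet distribution with parameter $\boldsymbol\alpha^j(A)$. This yields $T_0^{k+1}\supset T_0^k$ and $T_1^{k+1}\subset T_1^k$. For $B\subset T_0^{k+1}$ set $Q^{(k+1)}(B)=Q^{(k)}(B)$. If $T_1^{k+1}=\bigcup_i A_i$ with $A_i\in\mathcal{A}^{k+1}$ disjoint, then for $B\subset T_1^{k+1}$ set $Q^{(k+1)}(B)=\sum_i Q^{(k+1)}(A_i)\,\mu(A_i\cap B)/\mu(A_i)$. **Optional Pólya tree.** Under the stated condition on $\rho$, with probability $1$ the measures $Q^{(k)}$ converge in variational distance to a probability measure $Q$ that is absolutely continuous with respect to $\mu$. This random probability measure $Q$ is said to have an optional Pólya tree distribution with parameters $\boldsymbol\lambda,\boldsymbol\alpha$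 and stopping rule $\rho$.
   Formalization: The assumption that open sets B are increasing limits of finite unions B_n of disjoint elementary regions is strengthened: for each n, the regions used must come from one partitioning the scheme can produce, the same for all B; with arbitrary disjoint regions the claim is false. *)

(* Defs.v *)
From HB Require Import structures.
From mathcomp Require Import all_boot all_order all_algebra.
From mathcomp Require Import all_classical all_reals all_analysis.

Set Implicit Arguments.
Unset Strict Implicit.
Unset Printing Implicit Defensive.

Import Order.TTheory GRing.Theory Num.Theory.
Import numFieldNormedType.Exports.

Local Open Scope classical_set_scope.
Local Open Scope ring_scope.

(* Points of R^n are n-tuples; their measurable sets are those of the library,
   generated by the coordinates (the Borel sets of R^n). *)

Definition tuple_cons (R : realType) n (x : R * n.-tuple R) : n.+1.-tuple R :=
  [the n.+1.-tuple R of x.1 :: x.2].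

Lemma measurable_tuple_cons (R : realType) n :
  measurable_fun [set: R * n.-tuple R] (@tuple_cons R n).
Proof. exact: measurable_cons. Qed.

Section lebesgue_succ.
Context (R : realType) (n : nat).
Variable m : {sigma_finite_measure set (n.-tuple R) -> \bar R}.
Local Open Scope ereal_scope.

Definition lebesgue_succ : set (n.+1.-tuple R) -> \bar R :=
  fun A => (@lebesgue_measure R \x m) (@tuple_cons R n @^-1` A).

Let lebesgue_succ0 : lebesgue_succ set0 = 0.
Proof. by rewrite /lebesgue_succ preimage_set0 measure0. Qed.

Let lebesgue_succ_ge0 A : 0 <= lebesgue_succ A.
Proof. exact: measure_ge0. Qed.

Let lebesgue_succ_additive : semi_sigma_additive lebesgue_succ.
Proof.
have mc A : measurable A -> measurable (@tuple_cons R n @^-1` A).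
  by move=> mA; rewrite -[X in measurable X]setTI; exact: measurable_tuple_cons.
move=> F mF tF mUF; rewrite /lebesgue_succ preimage_bigcup.
apply: measure_semi_sigma_additive => //.
- by move=> k; exact: mc.
- apply/trivIsetP => i j _ _ ij; rewrite -preimage_setI.
  by move/trivIsetP : tF => /(_ _ _ _ _ ij) ->//; rewrite preimage_set0.
- by rewrite -preimage_bigcup; exact: mc.
Qed.

HB.instance Definition _ := isMeasure.Build _ _ _ lebesgue_succ
  lebesgue_succ0 lebesgue_succ_ge0 lebesgue_succ_additive.

Let lebesgue_succ_sigma_finite : sigma_finite setT lebesgue_succ.
Proof.
have /sigma_finiteP[F [FT Fnd Foo]] := sigma_finiteT (@lebesgue_measure R).
have /sigma_finiteP[G [GT Gnd Goo]] := sigma_finiteT m.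
pose uncons (t : n.+1.-tuple R) : measurableTypeR R * n.-tuple R :=
  (thead t, [tuple of behead t]).
have mu : measurable_fun [set: n.+1.-tuple R] uncons.
  by apply: measurable_fun_pair; [exact: measurable_tnth|exact: measurable_behead].
exists (fun i => uncons @^-1` (F i `*` G i)).
  rewrite -preimage_bigcup; apply/esym/seteqP; split=> // t _ /=.
  have : [set: R] (thead t) by [].
  rewrite FT => -[i _ Fi].
  have : [set: n.-tuple R] [tuple of behead t] by [].
  rewrite GT => -[j _ Gj].
  exists (maxn i j) => //; split=> /=.
    by have /subsetPset := Fnd _ _ (leq_maxl i j); exact.
  by have /subsetPset := Gnd _ _ (leq_maxr i j); exact.
move=> i; have [mF Fi] := Foo i; have [mG Gi] := Goo i; split.
  by rewrite -[X in measurable X]setTI; apply: mu => //; exact: measurableX.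
rewrite /lebesgue_succ -comp_preimage (_ : uncons \o _ = id).
  by rewrite preimage_id product_measure1E// lte_mul_pinfty// ge0_fin_numE.
by apply/funext => -[x t]; congr pair; apply: val_inj.
Qed.

HB.instance Definition _ := Measure_isSigmaFinite.Build _ _ _ lebesgue_succ
  lebesgue_succ_sigma_finite.

End lebesgue_succ.

(* n-dimensional Lebesgue measure; R^0 is a point of mass 1. *)
Fixpoint lebesgue (R : realType) n :
    {sigma_finite_measure set (n.-tuple R) -> \bar R} :=
  match n with
  | 0 => dirac ([tuple] : 0.-tuple R)
  | n.+1 => lebesgue_succ (lebesgue R n)
  end.

Lemma lebesgue_box (R : realType) n (A : 'I_n -> set R) :
  (forall i, measurable (A i)) ->
  lebesgue R n [set x | forall i, A i (tnth x i)] =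
  (\prod_(i < n) lebesgue_measure (A i))%E.
Proof.
elim: n A => [|n IH] A mA /=.
  rewrite big_ord0 (_ : [set x | _] = setT) ?diracT//.
  by apply/seteqP; split=> // x _ [].
rewrite big_ord_recl -IH// -product_measure1E//; last first.
  rewrite [X in measurable X](_ : _ =
    \bigcap_(i in [set: 'I_n]) ((@tnth _ _)^~ i @^-1` A (lift ord0 i))); last first.
    by apply/seteqP; split=> x /= xA i; [move=> _; exact: xA|exact: xA].
  apply: fin_bigcap_measurable => // i _; rewrite -[X in measurable X]setTI.
  exact: measurable_tnth.
  exact: mA.
rewrite /lebesgue_succ; set B := _ @^-1` _; set C := _ `*` _.
suff -> : B = C by [].
apply/seteqP; split=> -[x t] /=.
  move=> xA; split=> [|i]; first exact: (xA ord0).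
  by have := xA (lift ord0 i); rewrite tnthS.
move=> [xA tA] i; have [j ->|->//] := unliftP ord0 i.
by rewrite [X in A _ X]tnthS; exact: tA.
Qed.

Definition open_tuple (R : realType) n (B : set (n.-tuple R)) :=
  open [set v : 'rV[R]_n | B [tuple v ord0 i | i < n]].

Definition rectangle (R : realType) n (I : 'I_n -> interval R) :
  set (n.-tuple R) := [set x | forall i, tnth x i \in I i].

(* The last coordinate is 1 minus the sum of the others. *)
Definition simplex_point (R : realType) n (y : n.-1.-tuple R) : n.-tuple R :=
  [tuple nth 0 (rcons y (1 - \sum_(t <- y) t)) i | i < n].

(* Unnormalised Dirichlet density, in the first n - 1 coordinates. *)
Definition dirichlet_density (R : realType) n (a : nat -> R) (y : n.-1.-tuple R) : R :=
  let x := simplex_point y in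
  if [forall i, 0 < tnth x i] then \prod_(i < n) tnth x i `^ (a i - 1) else 0.

(* Dirichlet distribution on R^n with parameter (a 0, ..., a (n - 1)); for n = 1
   it is the point mass at 1. *)
Definition dirichlet (R : realType) n (a : nat -> R) (U : set (n.-tuple R)) : R :=
  fine (\int[lebesgue R n.-1]_(y in @simplex_point R n @^-1` U)
          (dirichlet_density a y)%:E)%E /
  fine (\int[lebesgue R n.-1]_y (dirichlet_density a y)%:E)%E.

(* The regions, ways and pieces are indexed from 0; nothing is assumed about the
   values of these functions outside elementary regions and valid indices. *)
Record scheme (R : realType) (T : Type) := Scheme {
  nways : set T -> nat ;
  nparts : set T -> nat -> nat ;
  part : set T -> nat -> nat -> set T ;
  selection : set T -> nat -> R ;
  assignment : set T -> nat -> nat -> R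
}.

Section scheme_theory.
Context (R : realType) (p : nat).
Let T := p.-tuple R.
Variables (Omega : set T) (G : scheme R T).

(* Regions of level k obtained from Omega when a region A may only be split in
   the ways j such that W A j. *)
Inductive region (W : set T -> nat -> Prop) : nat -> set T -> Prop :=
| region_root : region W 0 Omega
| region_part k A j l : region W k A -> (j < nways G A)%N -> W A j ->
    (l < nparts G A j)%N -> region W k.+1 (part G A j l).

Definition elementary := region (fun _ _ => True).

Definition valid_scheme := forall k A, elementary k A ->
  [/\ measurable A,
      (0 < lebesgue R p A)%E,
      (0 < nways G A)%N,
      (forall j, (j < nways G A)%N ->
        [/\ trivIset [set l | (l < nparts G A j)%N] (part G A j),
            A = \bigcup_(l in [set l | (l < nparts G A j)%N]) part G A j l
          & forall l, (l < nparts G A j)%N -> 0 < assignment G A j l])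
    & (forall j, (j < nways G A)%N -> 0 <= selection G A j) /\
      \sum_(j < nways G A) selection G A j = 1].

(* Open sets are increasing limits of finite disjoint unions of elementary
   regions.  The regions used at stage n must be produced together by one run of
   the partitioning (the one that splits each region A in the way c n A), the
   same for all B: arbitrary disjoint elementary regions may come from
   incompatible ways of splitting, so that no partition contains them all. *)
Definition generates_open_sets := exists c : nat -> set T -> nat,
  forall B : set T, open_tuple B -> B `<=` Omega ->
  exists Bn : nat -> set T,
    [/\ forall n, Bn n `<=` Bn n.+1,
        \bigcup_n Bn n = B
      & forall n, exists D : seq (set T),
          [/\ forall A, A \in D -> exists2 k, (1 <= k <= n)%N &
                region (fun A' j => j = c n A') k A,
              {in D &, forall A A', A != A' -> A `&` A' = set0}
            & Bn n = \bigcup_(A in [set` D]) A]].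

Definition bounded_away (eta : R) := forall k A j,
  elementary k A -> (j < nways G A)%N ->
  eta <= selection G A j <= 1 - eta /\
  forall l, (l < nparts G A j)%N ->
    eta <= assignment G A j l / \sum_(i < nparts G A j) assignment G A j i
        <= 1 - eta.

Definition uniform_on (A B : set T) : R :=
  fine (lebesgue R p (A `&` B)) / fine (lebesgue R p A).

End scheme_theory.

(* The variables drawn in step k + 1 for a region A of level k: the stopping
   indicator, the way J, and the weights theta_l^j; rho k A is the stopping
   probability of A. *)
Record draws d (Xi : measurableType d) (R : realType) (P : probability Xi R)
    (T : Type) := Draws {
  stop : nat -> set T -> {RV P >-> bool} ;
  way : nat -> set T -> {RV P >-> nat} ;
  theta : nat -> set T -> nat -> nat -> {RV P >-> R} ;
  rho : nat -> set T -> Xi -> R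
}.

Section process.
Context (R : realType) (p : nat).
Let T := p.-tuple R.
Variables (Omega : set T) (G : scheme R T).
Context d (Xi : measurableType d) (P : probability Xi R).
Variable V : draws P T.

(* The regions of the continuing part after k steps. *)
Fixpoint cells (k : nat) (w : Xi) : seq (set T) :=
  match k with
  | 0 => [:: Omega]
  | k.+1 => flatten
      [seq [seq part G A (way V k A w) l | l <- iota 0 (nparts G A (way V k A w))]
      | A <- cells k w & ~~ stop V k A w]
  end.

Fixpoint stopped_part (k : nat) (w : Xi) : set T :=
  match k with
  | 0 => set0
  | k.+1 => stopped_part k w `|`
      \bigcup_(A in [set A | A \in cells k w /\ stop V k A w]) A
  end.

Fixpoint opt_measure (k : nat) (w : Xi) (B : set T) : R :=
  match k with
  | 0 => uniform_on Omega B
  | k.+1 => opt_measure k w (B `&` stopped_part k.+1 w) +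
      \sum_(A <- cells k w | ~~ stop V k A w)
        \sum_(l < nparts G A (way V k A w))
          opt_measure k w A * theta V k A (way V k A w) l w *
          uniform_on (part G A (way V k A w) l) B
  end.

Definition active k A : set Xi := [set w | A \in cells k w].

(* An outcome of the draws for A: either A is stopped, or it is split in the way
   j with theta^j in U. *)
Definition outcome k A (s : bool) (j : nat) (U : set ((nparts G A j).-tuple R)) :
    set Xi :=
  if s then [set w | stop V k A w]
  else [set w | [/\ ~~ stop V k A w, way V k A w = j :> nat
                 & U [tuple theta V k A j i w | i < nparts G A j]]].

Definition outcome_prob k A (s : bool) (j : nat)
    (U : set ((nparts G A j).-tuple R)) (w : Xi) : R :=
  if s then rho V k A w
  else (1 - rho V k A w) * (selection G A j * dirichlet (assignment G A j) U).

(* The sigma-field generated by the variables used in the first k steps. *)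
Definition history (k : nat) : set (set Xi) :=
  <<s [set E | exists i A s j (U : set ((nparts G A j).-tuple R)),
         [/\ (i < k)%N, measurable U & E = active i A `&` outcome i s U]] >>.

Definition rho_adapted := forall k A, elementary Omega G k A ->
  (forall Y : set R, measurable Y ->
     history k (active k A `&` rho V k A @^-1` Y)) /\
  forall w, active k A w -> 0 <= rho V k A w <= 1.

(* Given the first k steps, the draws for the active regions are independent
   with the prescribed laws: the conditional probability of an intersection of
   outcomes is the product of their probabilities, the conditioning being
   expressed by integration over the events F of the history. *)
Definition conditional_laws := forall k (D : seq (set T)) (F : set Xi)
    (s : set T -> bool) (j : set T -> nat)
    (U : forall A, set ((nparts G A (j A)).-tuple R)),
  uniq D -> history k F ->
  (forall A, A \in D ->
    [/\ elementary Omega G k A, F `<=` active k A, (j A < nways G A)%N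
      & measurable (U A)]) ->
  P (F `&` \bigcap_(A in [set` D]) outcome k (s A) (U A)) =
  (\int[P]_(w in F) (\prod_(A <- D) outcome_prob k (s A) (U A) w)%R%:E)%E.

Definition optional_stopping_process := rho_adapted /\ conditional_laws.

Definition cvg_in_variation (w : Xi) (nu : set T -> \bar R) :=
  ereal_sup [set `|(opt_measure k w B)%:E - nu B|%E | B in measurable]
    @[k --> \oo] --> 0%E.

End process.

Definition density_of (R : realType) p (Omega : set (p.-tuple R))
    (nu : set (p.-tuple R) -> \bar R) (g : p.-tuple R -> R) :=
  [/\ measurable_fun Omega g, forall x, Omega x -> 0 <= g x
    & forall B, measurable B ->
        (nu B = \int[lebesgue R p]_(x in B `&` Omega) (g x)%:E)%E].

Definition probability_density (R : realType) p (Omega : set (p.-tuple R))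
    (f : p.-tuple R -> R) :=
  [/\ measurable_fun Omega f, forall x, Omega x -> 0 <= f x
    & (\int[lebesgue R p]_(x in Omega) (f x)%:E = 1)%E].

(* For measurable X this is 0 < P X.  The event in the theorem is defined through
   an almost sure limit, hence measurable only up to a P-null set. *)
Definition positive_probability d (Xi : measurableType d) (R : realType)
    (P : probability Xi R) (X : set Xi) :=
  exists E, [/\ measurable E, E `<=` X & (0 < P E)%E].

(* Main.v *)
(* A density f that is positive on Omega is approximated in L1 by the step
   function h averaging f over the cells of level n of one deterministic run of
   the partitioning (a general f is first mixed with the uniform density).
   With positive probability the process follows this run for n steps, with
   all Dirichlet weights close to the ratios of the masses that f gives to the
   cells, and then stops on every cell of level n: rho stays away from 0 and 1,
   the selection probabilities are positive, and a Dirichlet law charges every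
   neighbourhood of an interior point of the simplex.  On this event the
   process is constant from step n + 1 on, so the density q of its limit is a
   step function on the same cells, with masses close to those of h. *)
Require Import Defs.
From HB Require Import structures.
From mathcomp Require Import all_boot all_order all_algebra.
From mathcomp Require Import all_classical all_reals all_analysis.
From mathcomp Require Import measurable_realfun ring lra.

Import Order.TTheory GRing.Theory Num.Theory.
Import numFieldNormedType.Exports.

Local Open Scope classical_set_scope.
Local Open Scope ring_scope.

Set Implicit Arguments.
Unset Strict Implicit.
Unset Printing Implicit Defensive.

(** * Dirichlet integrals *)

(** The density in [dirichlet] is unbounded when some weight is below 1, and its normalising
    integral enters through [fine], which would turn [+oo] into 0 and make the whole quotient 0.
    Finiteness therefore has to be proved; a crude bound is enough, without values of Beta or Gamma
    functions. The runs attached to different [n] need not refine one another, since the way [c n A]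
    may change with [n]. Approximation is therefore asked for at all large [n], so that two sets or
    two functions can be treated in one common run. The step function takes averages of [f] because
    the masses of its cells are then additive: their ratios are probability vectors, which Dirichlet
    weights can imitate. Averaging costs at most a factor 2 compared with the best step function on
    the same cells. The level [n] is fixed before the tolerance [eps] on the weights, because [n]
    successive splits compound the error to (1 + eps)^n - 1. *)

Section dirichlet_integral.
Context (R : realType).
Implicit Types (a s x y : R).

(** The value 0 off the positive half-line turns the positivity test of [dirichlet_density] into a
    product of one-variable factors. *)
Definition pos_pow a x : R := if 0 < x then x `^ (a - 1) else 0.

Lemma pos_pow_ge0 a x : 0 <= pos_pow a x.
Proof. by rewrite /pos_pow; case: ifP => // x0; exact: powR_ge0. Qed.

Lemma measurable_pos_pow a : measurable_fun [set: R] (pos_pow a).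
Proof.
apply: measurable_fun_ifT => //; first exact: measurable_fun_ltr.
Qed.

(** The integrand may blow up at 0, so the fundamental theorem of calculus is applied, with
    primitive x^a / a, on closed intervals inside ]0, s]; monotone convergence gives the limit. *)
Lemma integral_pos_pow a s : 0 < a -> 0 < s <= 1 ->
  (\int[lebesgue_measure]_(x in [set x : R | (x <= s)%R]) (pos_pow a x)%:E
    <= (a^-1)%:E)%E.
Proof.
move=> a0 /andP[s0 s1].
(* With [n.+2] the left end is strictly below [s] already for n = 0. *)
pose F n : set R := [set` `[s / n.+2%:R, s]].
have FE : \bigcup_n F n = [set` `]0, s]].
  apply/seteqP; split=> x /=.
    move=> [n _]; rewrite /F/= !in_itv/= => /andP[h ->]; rewrite andbT.
    by apply: lt_le_trans h; rewrite divr_gt0.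
  rewrite in_itv/= => /andP[x0 xs].
  have [n hn] : exists n, s / x < n.+2%:R.
    exists (Num.trunc (s / x)).
    apply: (@lt_trans _ _ (Num.trunc (s / x)).+1%:R); last by rewrite ltr_nat.
    by rewrite truncnS_gt.
  exists n => //; rewrite /F/= in_itv/= xs andbT ler_pdivrMr//.
  by rewrite mulrC -ler_pdivrMr//; exact: ltW.
have mF n : measurable (F n) by exact: measurable_itv.
have mp : measurable_fun [set: R] (fun x => (pos_pow a x)%:E).
  by apply/measurable_EFinP; exact: measurable_pos_pow.
have -> : (\int[lebesgue_measure]_(x in [set x : R | (x <= s)%R]) (pos_pow a x)%:E
   = \int[lebesgue_measure]_(x in \bigcup_n F n) (pos_pow a x)%:E)%E.
  rewrite FE integral_mkcond [RHS]integral_mkcond; apply: eq_integral => x _.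
  rewrite !patchE !mem_setE in_itv/= /pos_pow.
  by case: ltP => //= x0; case: ifP.
apply: (@cvge_le _ \oo _ _ (fun i => \int[lebesgue_measure]_(x in F i) (pos_pow a x)%:E)%E); last first.
  apply: ge0_nondecreasing_set_cvg_integral => //.
  - apply/nondecreasing_seqP => n; rewrite subsetEset => x; rewrite /F/=.
    rewrite !in_itv/= => /andP[h ->]; rewrite andbT; apply: le_trans h.
    by rewrite ler_pM2l// lef_pV2 ?posrE// ler_nat.
  - by move=> n; exact: measurable_funTS.
  - by move=> n x _; rewrite lee_fin pos_pow_ge0.
apply: nearW => n /=.
have sn0 : 0 < s / n.+2%:R by rewrite divr_gt0.
have sns : s / n.+2%:R < s by rewrite ltr_pdivrMr// ltr_pMr// ltr1n.
have -> : (\int[lebesgue_measure]_(x in F n) (pos_pow a x)%:E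
    = \int[lebesgue_measure]_(x in F n) (x `^ (a - 1))%:E)%E.
  apply: eq_integral => x; rewrite inE /F /= in_itv/= => /andP[h _].
  by rewrite /pos_pow (lt_le_trans sn0 h).
have cpow (b x : R) : 0 < x -> {for x, continuous (fun y : R => y `^ b)}.
  move=> x0; apply: differentiable_continuous; apply/derivable1_diffP.
  by apply: derivable_powR; rewrite ?in_itv/= ?andbT.
rewrite (@continuous_FTC2 _ _ (fun x => a^-1 * x `^ a))//.
- rewrite -EFinB lee_fin lerBlDr.
  apply: (@le_trans _ _ a^-1); last by rewrite lerDl mulr_ge0 ?powR_ge0// invr_ge0 ltW.
  rewrite ler_piMr ?invr_ge0//; first exact: ltW.
  have := @ge0_ler_powR R a (ltW a0) s 1; rewrite powR1; apply => //.
  + by rewrite nnegrE ltW.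
  + by rewrite nnegrE.
- apply: continuous_in_subspaceT => x; rewrite inE/= in_itv/= => /andP[h _].
  by apply: cpow; apply: lt_le_trans h.
- split.
  + move=> x; rewrite in_itv/= => /andP[h _].
    have x0 := lt_trans sn0 h.
    by apply: derivableM => //; apply: derivable_powR; rewrite ?in_itv/= ?andbT.
  + apply: cvgMr; apply: cvg_at_right_filter; exact: cpow.
  + apply: cvgMr; apply: cvg_at_left_filter; exact: cpow.
- move=> x; rewrite in_itv/= => /andP[h _].
  have x0 := lt_trans sn0 h.
  have dp := is_derive1_powR a x0.
  rewrite derive1Ml; last by apply: ex_derive.
  by rewrite derive1E derive_val mulrA mulVf ?mul1r// gt_eqF.
Qed.

(** By uniqueness of Lebesgue measure only half-open intervals matter, and the reflection exchanges
    their ends and keeps their length. *)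
Lemma pushforward_subr s (A : set R) : measurable A ->
  pushforward lebesgue_measure ((fun x => s - x) : _ -> measurableTypeR R) A
  = lebesgue_measure A.
Proof.
move=> mA.
have mph : measurable_fun [set: measurableTypeR R]
   ((fun x => s - x) : _ -> measurableTypeR R).
  exact: measurable_funB.
pose ph : {mfun (measurableTypeR R) >-> (measurableTypeR R)} :=
  HB.pack ((fun x : R => s - x) : measurableTypeR R -> measurableTypeR R)
   (isMeasurableFun.Build _ _ _ _ _ mph).
apply/esym/(@lebesgue_measure_unique R (pushforward lebesgue_measure ph)) => //= _ [[a b]] _ <-.
rewrite /pushforward (_ : _ @^-1` _ = [set` `[s - b, s - a[]); last first.
  apply/seteqP; split=> x /=; rewrite !in_itv/= => /andP[? ?]; apply/andP; split; lra.
rewrite !lebesgue_measure_itv/= !lte_fin ltrD2l ltrN2.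
by case: ifP => // _; rewrite -!EFinB; congr (_%:E); ring.
Qed.

Lemma integral_pos_pow_sub a s : 0 < a -> 0 < s <= 1 ->
  (\int[lebesgue_measure]_(x in [set x : R | (0 <= x)%R]) (pos_pow a (s - x)%R)%:E
    <= (a^-1)%:E)%E.
Proof.
move=> a0 s01; apply: le_trans (integral_pos_pow a0 s01).
have -> : [set x : R | (0 <= x)%R] =
    ((fun x => s - x) : _ -> measurableTypeR R) @^-1` [set x : R | (x <= s)%R].
  by apply/seteqP; split => x /=; rewrite gerBl.
have mph : measurable_fun [set: measurableTypeR R]
   ((fun x => s - x) : _ -> measurableTypeR R).
  exact: measurable_funB.
have mD : measurable ([set x : R | (x <= s)%R] : set (measurableTypeR R)).
  by rewrite -set_itvNyc; exact: measurable_itv.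
have mp : measurable_fun [set: R] (fun x => (pos_pow a x)%:E).
  by apply/measurable_EFinP; exact: measurable_pos_pow.
rewrite -(@ge0_integral_pushforward _ _ _ _ _ _ mph _ _ (fun x => (pos_pow a x)%:E))//.
- rewrite le_eqVlt; apply/orP; left; apply/eqP.
  by apply: eq_measure_integral => A mA _; exact: pushforward_subr.
- exact: measurable_funS mp.
- by move=> y _; rewrite lee_fin pos_pow_ge0.
Qed.

End dirichlet_integral.

(** * Integration one coordinate at a time and bounds on the simplex *)

Section lebesgue_integral_succ.
Context (R : realType).

(** This is Tonelli, [lebesgue_succ] being the pushforward of a product measure by [tuple_cons]. *)
Lemma ge0_integral_lebesgue_succ n (f : n.+1.-tuple R -> \bar R) :
  measurable_fun [set: n.+1.-tuple R] f -> (forall x, 0 <= f x)%E ->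
  (\int[lebesgue R n.+1]_x f x =
   \int[lebesgue_measure]_t \int[lebesgue R n]_y f (tuple_cons (t, y)))%E.
Proof.
move=> mf f0.
have mc : measurable_fun [set: measurableTypeR R * n.-tuple R] (@tuple_cons R n)
  := @measurable_tuple_cons R n.
transitivity (\int[pushforward (@lebesgue_measure R \x lebesgue R n)
    (@tuple_cons R n)]_x f x)%E.
  by apply: eq_measure_integral.
rewrite (@ge0_integral_pushforward _ _ _ _ _ _ mc)//.
rewrite preimage_setT fubini_tonelli1//; last by move=> x; exact: f0.
exact: measurableT_comp.
Qed.

Lemma integral_lebesgue0 (f : 0.-tuple R -> \bar R) :
  (\int[lebesgue R 0]_x f x = f [tuple])%E.
Proof.
rewrite integral_dirac ?diracT ?mul1e//.
rewrite (_ : f = cst (f [tuple])); first exact: measurable_cst.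
by apply/funext => x; rewrite (tuple0 x).
Qed.

End lebesgue_integral_succ.

Section dirichlet_bound.
Context (R : realType).
Implicit Types (a s : R).

(* On [0, s] the larger of x and s - x is at least s / 2, so for a <= 1
   pos_pow a x * pos_pow a (s - x) is at most
   pos_pow a (s / 2) * (pos_pow a x + pos_pow a (s - x)). *)
Lemma integral_beta a : 0 < a <= 1 -> exists2 C, 0 <= C & forall s, s <= 1 ->
  (\int[lebesgue_measure]_x (pos_pow a x * pos_pow a (s - x))%:E
   <= (C * pos_pow a s)%:E)%E.
Proof.
move=> /andP[a0 a1]; exists ((2^-1) `^ (a - 1) * (a^-1 + a^-1)).
  by rewrite mulr_ge0 ?powR_ge0// addr_ge0// invr_ge0 ltW.
move=> s s1; have [s0|s0] := leP s 0.
  rewrite integral0_eq ?lee_fin ?mulr_ge0 ?powR_ge0 ?pos_pow_ge0//.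
    by rewrite addr_ge0// invr_ge0 ltW.
  move=> x _; rewrite /pos_pow; case: ltP => x0; last by rewrite mul0r.
  by rewrite ifF ?mulr0//; apply/negbTE; rewrite -leNgt; lra.
have mp : measurable_fun [set: R] (fun x => pos_pow a x) := measurable_pos_pow a.
have mps : measurable_fun [set: R] (fun x => pos_pow a (s - x)).
  by apply: measurableT_comp => //; exact: measurable_funB.
have mIs : measurable [set x : R | x <= s].
  by rewrite -set_itvNyc; exact: measurable_itv.
have mI0 : measurable [set x : R | 0 <= x].
  by rewrite -set_itvcy; exact: measurable_itv.
pose g1 x := pos_pow a x * \1_[set x : R | x <= s] x.
pose g2 x := pos_pow a (s - x) * \1_[set x : R | 0 <= x] x.
have g1_ge0 x : 0 <= g1 x by rewrite mulr_ge0 ?pos_pow_ge0.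
have g2_ge0 x : 0 <= g2 x by rewrite mulr_ge0 ?pos_pow_ge0.
have mg1 : measurable_fun [set: R] g1 by exact: measurable_funM.
have mg2 : measurable_fun [set: R] g2 by exact: measurable_funM.
apply: (@le_trans _ _ (\int[lebesgue_measure]_x
    ((2^-1 * s) `^ (a - 1) * (g1 x + g2 x))%:E)%E).
  apply: ge0_le_integral => //=.
  - by move=> x _; rewrite lee_fin mulr_ge0 ?pos_pow_ge0.
  - by apply/measurable_EFinP; exact: measurable_funM.
  - apply/measurable_EFinP; apply: measurable_funM => //; exact: measurable_funD.
  move=> x _; rewrite lee_fin.
  have [x0|x0] := leP x 0.
    rewrite {1}/pos_pow ltNge x0/= mul0r mulr_ge0 ?powR_ge0 ?addr_ge0//.
  have [xs|xs] := leP s x.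
    rewrite {2}/pos_pow ltNge (_ : s - x <= 0) ?subr_le0//= mulr0.
    by rewrite mulr_ge0 ?powR_ge0 ?addr_ge0.
  have half u : 2^-1 * s <= u -> u `^ (a - 1) <= (2^-1 * s) `^ (a - 1).
    move=> hu; have u0 : 0 < u by apply: lt_le_trans hu; rewrite mulr_gt0.
    rewrite -opprB !powRN lef_pV2 ?posrE ?powR_gt0 ?mulr_gt0//.
    by rewrite ge0_ler_powR ?nnegrE ?subr_ge0// ltW ?mulr_gt0.
  rewrite /g1 /g2 !indicE !mem_set ?mulr1; [|exact: ltW..].
  rewrite /pos_pow x0 subr_gt0 xs mulrDr.
  have [h|h] := leP (2^-1 * s) x.
    by rewrite ler_wpDl ?ler_wpM2r ?mulr_ge0 ?powR_ge0 ?half.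
  rewrite mulrC ler_wpDr ?ler_wpM2r ?mulr_ge0 ?powR_ge0 ?half//.
  by rewrite lerBrDr; lra.
under eq_integral do rewrite EFinM.
rewrite ge0_integralZl//=; last 3 first.
- by apply/measurable_EFinP; exact: measurable_funD.
- by move=> x _; rewrite lee_fin addr_ge0.
- by rewrite lee_fin powR_ge0.
under eq_integral do rewrite EFinD.
rewrite ge0_integralD//=; last 4 first.
- by move=> x _; rewrite lee_fin.
- exact/measurable_EFinP.
- by move=> x _; rewrite lee_fin.
- exact/measurable_EFinP.
rewrite powRM ?invr_ge0 ?(ltW s0)// /(pos_pow a s) s0.
rewrite mulrAC [in leRHS]EFinM lee_pmul2l//; last first.
  by rewrite lte_fin mulr_gt0 ?powR_gt0.
rewrite EFinD; apply: leeD.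
  apply: le_trans (integral_pos_pow a0 (introT andP (conj s0 s1))).
  rewrite [leRHS]integral_mkcond le_eqVlt; apply/orP; left; apply/eqP.
  apply: eq_integral => x _; rewrite /g1 patchE indicE.
  by case: ifP; rewrite ?mulr1 ?mulr0.
apply: le_trans (integral_pos_pow_sub a0 (introT andP (conj s0 s1))).
rewrite [leRHS]integral_mkcond le_eqVlt; apply/orP; left; apply/eqP.
apply: eq_integral => x _; rewrite /g2 patchE indicE.
by case: ifP; rewrite ?mulr1 ?mulr0.
Qed.

(** The Dirichlet density with all parameters equal to [a] on the simplex of total mass [s]. A
    variable total is needed because it shrinks when a coordinate is integrated out. *)
Definition simplex_weight a n s (y : n.-tuple R) : R :=
  (\prod_(i < n) pos_pow a (tnth y i)) * pos_pow a (s - \sum_(t <- y) t).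

Lemma simplex_weight_ge0 a n s (y : n.-tuple R) : 0 <= simplex_weight a s y.
Proof.
by rewrite mulr_ge0 ?pos_pow_ge0// prodr_ge0// => i _; exact: pos_pow_ge0.
Qed.

Lemma measurable_sum_tuple n :
  measurable_fun [set: n.-tuple R] (fun y : n.-tuple R => \sum_(t <- y) t).
Proof.
under eq_fun do rewrite big_tuple.
by apply: measurable_sum => i; exact: measurable_tnth.
Qed.

Lemma measurable_simplex_weight a n s :
  measurable_fun [set: n.-tuple R] (@simplex_weight a n s).
Proof.
apply: measurable_funM.
  apply: measurable_prod => i _.
  apply: measurableT_comp; [exact: measurable_pos_pow|exact: measurable_tnth].
apply: measurableT_comp; first exact: measurable_pos_pow.
by apply: measurable_funB => //; exact: measurable_sum_tuple.
Qed.

(** With the first coordinate [t] fixed, the induction hypothesis leaves a multiple of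
    [pos_pow a (s - t)], and [integral_beta] treats the integral in [t]. The exact beta integral is
    of order s^(2a - 1); for s <= 1 it is bounded by the weaker s^(a - 1), a shape that reproduces
    itself and closes the induction. *)
Lemma integral_simplex_weight a n : 0 < a <= 1 -> exists2 C, 0 <= C &
  forall s, s <= 1 ->
  (\int[lebesgue R n]_y (simplex_weight a s y)%:E <= (C * pos_pow a s)%:E)%E.
Proof.
move=> a01; have [B B0 HB] := integral_beta a01.
elim: n => [|n [C C0 IH]].
  exists 1 => // s s1; rewrite integral_lebesgue0 /simplex_weight big_ord0.
  by rewrite big_nil subr0.
exists (C * B); first exact: mulr_ge0.
move=> s s1; rewrite ge0_integral_lebesgue_succ; last 2 first.
- by apply/measurable_EFinP; exact: measurable_simplex_weight.
- by move=> x; rewrite lee_fin simplex_weight_ge0.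
apply: (@le_trans _ _ (\int[lebesgue_measure]_t
   (C * (pos_pow a t * pos_pow a (s - t)))%:E)%E).
  apply: ge0_le_integral => //=.
  - by move=> t _; apply: integral_ge0 => y _; rewrite lee_fin simplex_weight_ge0.
  - apply: (measurable_fun_fubini_tonelli_F
      (fun z : R * n.-tuple R => (simplex_weight a s (tuple_cons z))%:E)) => /=.
      apply/measurable_EFinP; apply: measurableT_comp.
        exact: measurable_simplex_weight.
      exact: measurable_tuple_cons.
    by move=> x; rewrite lee_fin simplex_weight_ge0.
  - apply/measurable_EFinP; apply: measurable_funM => //; apply: measurable_funM.
      exact: measurable_pos_pow.
    apply: measurableT_comp; first exact: measurable_pos_pow.
    exact: measurable_funB.
  move=> t _.
  have -> : (\int[lebesgue R n]_y (simplex_weight a s (tuple_cons (t, y)))%:E =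
      \int[lebesgue R n]_y ((pos_pow a t)%:E * (simplex_weight a (s - t) y)%:E))%E.
    apply: eq_integral => y _; rewrite -EFinM /simplex_weight big_ord_recl/=.
    rewrite big_cons opprD addrA (tnth_nth 0)/= mulrA.
    by under eq_bigr do rewrite tnthS.
  rewrite ge0_integralZl//=; last 3 first.
  - by apply/measurable_EFinP; exact: measurable_simplex_weight.
  - by move=> y _; rewrite lee_fin simplex_weight_ge0.
  - by rewrite lee_fin pos_pow_ge0.
  (* For [t <= 0] the condition [s - t <= 1] may fail, but then the factor [pos_pow a t] is 0. *)
  have [t0|t0] := leP t 0.
    by rewrite /pos_pow ltNge t0/= mul0e mul0r mulr0.
  rewrite mulrCA EFinM lee_wpmul2l ?lee_fin ?pos_pow_ge0//.
  by apply: IH; lra.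
under eq_integral do rewrite EFinM.
rewrite ge0_integralZl//=.
- by rewrite -mulrA EFinM lee_wpmul2l ?lee_fin// HB.
- apply/measurable_EFinP; apply: measurable_funM; first exact: measurable_pos_pow.
  apply: measurableT_comp; first exact: measurable_pos_pow.
  exact: measurable_funB.
- by move=> t _; rewrite lee_fin mulr_ge0 ?pos_pow_ge0.
Qed.

End dirichlet_bound.

(** * Dirichlet laws charge neighbourhoods of interior points *)

Lemma positive_lower_bound (R : realType) n (F : nat -> R) (x : R) : 0 < x ->
  (forall i, (i < n)%N -> 0 < F i) ->
  exists2 c, 0 < c <= x & forall i, (i < n)%N -> c <= F i.
Proof.
move=> x0 F0; exists (\big[Num.min/x]_(i < n) F i).
  rewrite bigmin_le_id andbT; apply: lt_bigmin => // i _; exact: F0.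
by move=> i ni; have := @bigmin_le _ _ _ x (Ordinal ni) (fun i : 'I_n => F i).
Qed.

(** A zero integral would force [f] to vanish almost everywhere on [D], making [D] null. *)
Lemma integral_gt0 d (T : measurableType d) (R : realType)
    (mu : {measure set T -> \bar R}) (D : set T) (f : T -> \bar R) :
  measurable D -> measurable_fun D f -> (forall x, D x -> 0 < f x)%E ->
  (0 < mu D)%E -> (0 < \int[mu]_(x in D) f x)%E.
Proof.
move=> mD mf f0 D0; rewrite lt0e integral_ge0 ?andbT; last first.
  by move=> x Dx; exact/ltW/f0.
apply/eqP => I0; have /(ae_eq_integral_abs mu mD mf) [N [mN N0 NP]] :
    (\int[mu]_(x in D) `|f x| = 0)%E.
  by rewrite -[RHS]I0; apply: eq_integral => x /[!inE] Dx; rewrite gee0_abs// ltW// f0.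
suff DN : D `<=` N by move: D0; rewrite ltNge -N0 le_measure ?inE.
by move=> x Dx; apply: NP => /(_ Dx) fx; have := f0 _ Dx; rewrite fx ltxx.
Qed.

Lemma widen_ord_or_max m (i : 'I_m.+1) :
  (exists j, i = widen_ord (leqnSn m) j) \/ i = ord_max.
Proof.
have [im|mi] := ltnP i m; first by left; exists (Ordinal im); exact: val_inj.
by right; apply/val_inj/eqP; rewrite eqn_leq mi -ltnS ltn_ord.
Qed.

Section dirichlet_positive.
Context (R : realType) (m : nat).
Implicit Types (y : m.-tuple R).

Lemma tnth_simplex_point_widen y (i : 'I_m) :
  tnth (@simplex_point R m.+1 y) (widen_ord (leqnSn m) i) = tnth y i.
Proof.
rewrite tnth_mktuple/= nth_rcons size_tuple ltn_ord.
by rewrite (tnth_nth 0).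
Qed.

Lemma tnth_simplex_point_max y :
  tnth (@simplex_point R m.+1 y) ord_max = 1 - \sum_(t <- y) t.
Proof. by rewrite tnth_mktuple/= nth_rcons size_tuple ltnn eqxx. Qed.

Lemma sum_simplex_point y : \sum_i tnth (@simplex_point R m.+1 y) i = 1.
Proof.
rewrite big_ord_recr/= tnth_simplex_point_max big_tuple.
by under eq_bigr do rewrite tnth_simplex_point_widen; rewrite subrKC.
Qed.

(** In product form, measurability and sign can be read off factor by factor. *)
Lemma dirichlet_densityE (a : nat -> R) y : @dirichlet_density R m.+1 a y =
  \prod_(i < m.+1) pos_pow (a i) (tnth (@simplex_point R m.+1 y) i).
Proof.
rewrite /dirichlet_density; case: ifPn => [/forallP h|].
  by apply: eq_bigr => i _; rewrite /pos_pow h.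
rewrite negb_forall => /existsP[i hi].
by rewrite (bigD1 i)//= /pos_pow (negbTE hi) mul0r.
Qed.

Lemma measurable_simplex_point :
  measurable_fun [set: m.-tuple R] (@simplex_point R m.+1).
Proof.
apply/measurable_fun_tnthP => i.
have [[j ->]|->] := widen_ord_or_max i.
  rewrite (_ : _ \o _ = fun y => tnth y j); first exact: measurable_tnth.
  by apply/funext => y; exact: tnth_simplex_point_widen.
rewrite (_ : _ \o _ = fun y : m.-tuple R => 1 - \sum_(t <- y) t).
  by apply: measurable_funB => //; exact: measurable_sum_tuple.
by apply/funext => y; exact: tnth_simplex_point_max.
Qed.

Lemma measurable_dirichlet_density (a : nat -> R) :
  measurable_fun [set: m.-tuple R] (@dirichlet_density R m.+1 a).
Proof.
rewrite (_ : @dirichlet_density R m.+1 a = fun y =>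
  \prod_(i < m.+1) pos_pow (a i) (tnth (@simplex_point R m.+1 y) i)); last first.
  by apply/funext => y; exact: dirichlet_densityE.
apply: measurable_prod => i _; apply: measurableT_comp.
  exact: measurable_pos_pow.
exact: (measurable_fun_tnthP _).1 measurable_simplex_point i.
Qed.

Lemma dirichlet_density_ge0 (a : nat -> R) y :
  0 <= @dirichlet_density R m.+1 a y.
Proof.
by rewrite dirichlet_densityE prodr_ge0// => i _; exact: pos_pow_ge0.
Qed.

(* All coordinates being at most 1, the exponents may be lowered to a common
   value in ]0, 1], the case treated by integral_simplex_weight. *)
Lemma dirichlet_integral_lty (a : nat -> R) :
  (forall i, (i < m.+1)%N -> 0 < a i) ->
  (\int[lebesgue R m]_y (@dirichlet_density R m.+1 a y)%:E < +oo)%E.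
Proof.
move=> a0; have [b b01 ba] := positive_lower_bound (@ltr01 R) a0.
have [C C0 HC] := integral_simplex_weight m b01.
apply: le_lt_trans (ltry (C * pos_pow b 1)); apply: le_trans (HC 1 (lexx 1)).
apply: ge0_le_integral => //=.
- by move=> y _; rewrite lee_fin dirichlet_density_ge0.
- by apply/measurable_EFinP; exact: measurable_dirichlet_density.
- by apply/measurable_EFinP; exact: measurable_simplex_weight.
move=> y _; rewrite lee_fin.
have -> : simplex_weight b 1 y =
    \prod_(i < m.+1) pos_pow b (tnth (@simplex_point R m.+1 y) i).
  rewrite big_ord_recr/= tnth_simplex_point_max.
  by under eq_bigr do rewrite tnth_simplex_point_widen.
rewrite /dirichlet_density; case: ifPn => [/forallP h|_]; last first.
  by rewrite prodr_ge0// => i _; exact: pos_pow_ge0.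
apply: ler_prod => i _; rewrite powR_ge0/= /pos_pow h.
apply: ger_powR; last by rewrite lerB// ba.
rewrite h/= -(sum_simplex_point y) (bigD1 i)//= lerDl sumr_ge0// => j _.
exact: ltW.
Qed.

(** A small box around the first [m] coordinates of [x] has positive volume, is mapped into the
    neighbourhood and carries a positive density, so the numerator is positive.
    [dirichlet_integral_lty] keeps both integrals finite, so that [fine] does not send them to 0. *)
Lemma dirichlet_gt0 (a x : nat -> R) (eps : R) :
  (forall i, (i < m.+1)%N -> 0 < a i) -> (forall i, (i < m.+1)%N -> 0 < x i) ->
  \sum_(i < m.+1) x i = 1 -> 0 < eps ->
  0 < @dirichlet R m.+1 a
    [set t | \sum_(i < m.+1) `|tnth t i - x i| < eps].
Proof.
move=> a0 x0 x1 eps0; rewrite /dirichlet/=.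
set S := _ @^-1` _.
have mS : measurable S.
  rewrite -[S]setTI; apply: measurable_simplex_point => //.
  rewrite -[X in measurable X]setTI -[X in measurable (_ `&` X)]/
     ((fun t : m.+1.-tuple R => \sum_(i < m.+1) `|tnth t i - x i|) @^-1`
       [set r | r < eps]).
  have : measurable_fun [set: m.+1.-tuple R]
      (fun t : m.+1.-tuple R => \sum_(i < m.+1) `|tnth t i - x i|).
    apply: measurable_sum => i; apply: measurableT_comp => //.
    by apply: measurable_funB => //; exact: measurable_tnth.
  by apply => //; rewrite -set_itvNyo; exact: measurable_itv.
have mdens : measurable_fun [set: m.-tuple R]
    (fun y => (@dirichlet_density R m.+1 a y)%:E).
  by apply/measurable_EFinP; exact: measurable_dirichlet_density.
have dens0 y : (0 <= (@dirichlet_density R m.+1 a y)%:E)%E.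
  by rewrite lee_fin dirichlet_density_ge0.
have [c /andP[c0 ceps] cx] :
    exists2 c, 0 < c <= eps / 2 & forall i, (i < m.+1)%N -> c <= x i.
  by apply: positive_lower_bound => //; rewrite divr_gt0.
(* The last coordinate collects the errors of the others, up to [r *+ m = c - r]. So the total error
   is at most 2 (c - r) < eps, and the last coordinate stays positive because [x m >= c]. *)
pose r := c / m.+1%:R.
have r0 : 0 < r by rewrite divr_gt0.
have rmc : r *+ m + r = c.
  by rewrite -mulrSr -[LHS]mulr_natr /r mulfVK.
pose A (i : 'I_m) : set R := `]x i - r, x i + r[%classic.
pose B : set (m.-tuple R) := [set y | forall i, A i (tnth y i)].
have mA i : measurable (A i) by exact: measurable_itv.
have mB : measurable B.
  rewrite (_ : B = \bigcap_(i in [set: 'I_m]) ((fun y : m.-tuple R => tnth y i) @^-1` A i)).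
    apply: fin_bigcap_measurable => // i _; rewrite -[X in measurable X]setTI.
    exact: measurable_tnth.
  by apply/seteqP; split => y /= h i; [move=> _|]; exact: h.
have B0 : (0 < lebesgue R m B)%E.
  rewrite lebesgue_box//; elim/big_ind : _ => //.
    by move=> u v u0 v0; exact: mule_gt0.
  move=> i _; rewrite lebesgue_measure_itv/= lte_fin ifT; last by lra.
  by rewrite -EFinB lte_fin; lra.
have dist y i : B y -> `|tnth y i - x i| < r.
  by move=> /(_ i); rewrite /A/= in_itv/= => /andP[? ?]; rewrite ltr_norml; lra.
have sumB y : B y -> \sum_(i < m) `|tnth y i - x i| <= r *+ m.
  move=> By; rewrite -[X in _ *+ X]card_ord -sumr_const.
  by apply: ler_sum => i _; exact/ltW/dist.
have xmax : x m = 1 - \sum_(i < m) x i by rewrite -x1 big_ord_recr/= addrC addrK.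
have lastE y : tnth (@simplex_point R m.+1 y) ord_max - x m =
    - \sum_(i < m) (tnth y i - x i).
  by rewrite tnth_simplex_point_max xmax big_tuple sumrB; ring.
have lastB y : B y -> `|tnth (@simplex_point R m.+1 y) ord_max - x m| <= r *+ m.
  move=> By; rewrite lastE normrN; apply: le_trans (sumB y By).
  exact: ler_norm_sum.
have BS : B `<=` S.
  move=> y By; rewrite /S/= big_ord_recr/=.
  under eq_bigr do rewrite tnth_simplex_point_widen.
  have := sumB _ By; have := lastB _ By; rewrite /=; lra.
have Bpos y : B y -> (0 < (@dirichlet_density R m.+1 a y)%:E)%E.
  move=> By; rewrite lte_fin dirichlet_densityE; apply: prodr_gt0 => i _.
  rewrite /pos_pow.
  suff hi : 0 < tnth (@simplex_point R m.+1 y) i by rewrite hi powR_gt0.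
  have [[j ->]|->] := widen_ord_or_max i.
  - rewrite tnth_simplex_point_widen; have := dist _ j By.
    have jm : (j < m.+1)%N by rewrite ltnS ltnW.
    have := cx j jm; have : 0 <= r *+ m by rewrite mulrn_wge0 ?ltW.
    rewrite ltr_norml; lra.
  - have := lastB _ By; have := cx m (ltnSn m).
    rewrite ler_norml; lra.
have IS0 : (0 < \int[lebesgue R m]_(y in S) (@dirichlet_density R m.+1 a y)%:E)%E.
  apply: (@lt_le_trans _ _
     (\int[lebesgue R m]_(y in B) (@dirichlet_density R m.+1 a y)%:E)%E).
    by apply: integral_gt0 => //; exact: measurable_funTS.
  by apply: ge0_subset_integral => //; exact: measurable_funTS.
have ISle : (\int[lebesgue R m]_(y in S) (@dirichlet_density R m.+1 a y)%:E <=
    \int[lebesgue R m]_y (@dirichlet_density R m.+1 a y)%:E)%E.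
  by apply: ge0_subset_integral.
have fin := dirichlet_integral_lty a0.
rewrite divr_gt0// fine_gt0//; first by rewrite IS0 (le_lt_trans ISle).
by rewrite fin (lt_le_trans IS0).
Qed.

End dirichlet_positive.
(** * Deterministic runs of the partitioning *)

Section run.
Context (R : realType) (p : nat).
Notation T := (p.-tuple R).
Variables (Omega : set T) (G : scheme R T).
Notation mu := (lebesgue R p).

Fixpoint run (c : set T -> nat) (k : nat) : seq (set T) :=
  if k is k'.+1 then
    flatten [seq [seq part G A (c A) l | l <- iota 0 (nparts G A (c A))]
            | A <- run c k']
  else [:: Omega].

Lemma big_run (V : Type) (idx : V) (op : Monoid.law idx) c k (F : set T -> V) :
  \big[op/idx]_(A <- run c k.+1) F A =
  \big[op/idx]_(A <- run c k)
    \big[op/idx]_(l < nparts G A (c A)) F (part G A (c A) l).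
Proof.
rewrite /= big_flatten big_map; apply: eq_bigr => A _.
by rewrite big_map -{1}[nparts G A (c A)]subn0 big_mkord.
Qed.

Lemma mem_runS c k B : reflect
  (exists A l, [/\ A \in run c k, (l < nparts G A (c A))%N & B = part G A (c A) l])
  (B \in run c k.+1).
Proof.
apply: (iffP flatten_mapP) => [[A Ak /mapP[l]]|[A [l [Ak lA ->]]]].
  by rewrite mem_iota => /= lA ->; exists A, l.
by exists A => //; apply/mapP; exists l; rewrite ?mem_iota.
Qed.

Hypothesis vG : valid_scheme Omega G.
Variable c : set T -> nat.
Hypothesis c_lt : forall k A, elementary Omega G k A -> (c A < nways G A)%N.

Lemma run_elementary k A : A \in run c k -> elementary Omega G k A.
Proof.
elim: k A => [|k IH] A; first by rewrite inE => /eqP ->; exact: region_root.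
move=> /mem_runS[B [l [/IH Bk lB ->]]].
by apply: region_part => //; exact: c_lt Bk.
Qed.

Lemma run_measurable k A : A \in run c k -> measurable A.
Proof. by move=> /run_elementary /vG[]. Qed.

Lemma run_measure_gt0 k A : A \in run c k -> (0 < mu A)%E.
Proof. by move=> /run_elementary /vG[]. Qed.

Lemma run_part k A : A \in run c k ->
  [/\ trivIset [set l | (l < nparts G A (c A))%N] (part G A (c A)),
      A = \bigcup_(l in [set l | (l < nparts G A (c A))%N]) part G A (c A) l
    & forall l, (l < nparts G A (c A))%N -> 0 < assignment G A (c A) l].
Proof.
by move=> /run_elementary Ak; have [_ _ _ h _] := vG Ak; apply/h/c_lt/Ak.
Qed.

Lemma run_part_sub k A l : A \in run c k -> (l < nparts G A (c A))%N ->
  part G A (c A) l `<=` A.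
Proof. by move=> /run_part[_ AE _] lA x xl; rewrite AE; exists l. Qed.

Lemma run_sub k A : A \in run c k -> A `<=` Omega.
Proof.
elim: k A => [|k IH] A; first by rewrite inE => /eqP ->.
move=> /mem_runS[B [l [Bk lB ->]]]; apply: subset_trans (IH _ Bk).
exact: run_part_sub Bk lB.
Qed.

Lemma measurable_Omega : measurable Omega.
Proof. by have [] := vG (@region_root _ _ Omega G (fun _ _ => True)). Qed.

Definition step k (b : set T -> R) (x : T) : R := \sum_(A <- run c k) b A * \1_A x.

Lemma step_add k b b' x :
  step k (fun A => b A + b' A) x = step k b x + step k b' x.
Proof. by rewrite -big_split/=; apply: eq_bigr => A _; rewrite mulrDl. Qed.

Lemma step_scale k r b x : step k (fun A => r * b A) x = r * step k b x.
Proof. by rewrite mulr_sumr; apply: eq_bigr => A _; rewrite mulrA. Qed.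

(** At a fixed [x] the inner sums serve as coefficients of a step function of level [k], although
    they depend on [x]: each part lies in its cell. The lemmas on [step] then collapse the outer
    sum. *)
Lemma step_parts k (b : set T -> nat -> R) x :
  \sum_(A <- run c k) \sum_(l < nparts G A (c A)) b A l * \1_(part G A (c A) l) x =
  step k (fun A => \sum_(l < nparts G A (c A)) b A l * \1_(part G A (c A) l) x) x.
Proof.
rewrite /step big_seq [RHS]big_seq; apply: eq_bigr => A Ak.
rewrite mulr_suml; apply: eq_bigr => l _; rewrite -mulrA; congr (_ * _).
rewrite !indicE; have [xl|] := boolP (x \in part G A (c A) l); last by rewrite mul0r.
by rewrite mem_set ?mulr1//; apply: (run_part_sub Ak (ltn_ord l)); rewrite inE in xl.
Qed.

Lemma sum_part k A l0 (b : nat -> R) x : A \in run c k ->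
  (l0 < nparts G A (c A))%N -> part G A (c A) l0 x ->
  \sum_(l < nparts G A (c A)) b l * \1_(part G A (c A) l) x = b l0.
Proof.
move=> Ak l0A xl0; have [tA _ _] := run_part Ak.
rewrite (bigD1 (Ordinal l0A))//= indicE mem_set// mulr1 big1 ?addr0// => l ll0.
rewrite indicE memNset ?mulr0// => xl.
move/negP : ll0; apply; apply/eqP/val_inj => /=.
by apply: (tA l l0) => //=; exists x.
Qed.

(** The equality for all [b] encodes that [x] lies in exactly one entry of the list, counted with
    multiplicity. Disjointness and covering are both extracted from it. *)
Lemma run_cell k x : Omega x ->
  exists2 A, A \in run c k & A x /\ forall b, step k b x = b A.
Proof.
move=> Ox; elim: k => [|k [A Ak [Ax bA]]].
  exists Omega; first by rewrite inE.
  by split=> // b; rewrite /step big_seq1 indicE mem_set// mulr1.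
have [_ AE _] := run_part Ak.
have [l0 /= l0A xl0] : (\bigcup_(l in [set l | (l < nparts G A (c A))%N])
    part G A (c A) l) x by rewrite -AE.
exists (part G A (c A) l0); first by apply/mem_runS; exists A, l0.
split=> // b; rewrite {1}/step big_run.
rewrite (step_parts k (fun A l => b (part G A (c A) l))) bA.
exact: (sum_part (fun l => b (part G A (c A) l)) Ak l0A xl0).
Qed.

Lemma run_disjoint k A B x : A \in run c k -> B \in run c k -> A x -> B x -> A = B.
Proof.
move=> Ak Bk Ax Bx; have [C Ck [Cx bC]] := run_cell k (run_sub Ak Ax).
suff uniqC D : D \in run c k -> D x -> D = C by rewrite (uniqC A)// (uniqC B).
(* For [b] the indicator of [D], the sum contains the entry [D] and is at least 1, whereas [b C] is
   0 unless [C = D]. *)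
move=> Dk Dx; have := bC (fun E => (E == D)%:R); case: eqVneq => // _.
rewrite /step (perm_big _ (perm_to_rem Dk))/= big_cons eqxx mul1r indicE mem_set//.
move=> /eqP; rewrite gt_eqF// ltr_pwDl// sumr_ge0// => E _; rewrite mulr_ge0.
Qed.

Lemma step_cell k b A x : A \in run c k -> A x -> step k b x = b A.
Proof.
move=> Ak Ax; have [B Bk [Bx ->]] := run_cell k (run_sub Ak Ax).
by rewrite (run_disjoint Ak Bk Ax Bx).
Qed.

Lemma run_cover k : \bigcup_(A in [set` run c k]) A = Omega.
Proof.
apply/seteqP; split=> [x [A /= Ak]|x /(run_cell k)[A Ak [Ax _]]].
  exact: run_sub Ak x.
by exists A.
Qed.

Lemma run_nested k m A B : A \in run c k -> B \in run c (m + k) ->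
  B `<=` A \/ B `&` A = set0.
Proof.
move=> Ak; elim: m B => [|m IH] B.
  move=> Bk; have [[x [Bx Ax]]|BA] := pselect (exists x, B x /\ A x).
    by left; rewrite (run_disjoint Ak Bk Ax Bx).
  by right; rewrite -subset0 => x BAx; apply: BA; exists x.
move=> /mem_runS[C [l [Ck lC ->]]]; have [CA|CA] := IH _ Ck; [left|right].
  by apply: subset_trans CA; exact: run_part_sub Ck lC.
by rewrite -subset0 -CA; apply: setSI; exact: run_part_sub Ck lC.
Qed.

Lemma measurable_step k b : measurable_fun [set: T] (step k b).
Proof.
(* [measurable_sum] wants every term measurable, which is known for cells only; the other terms are
   replaced by 0. *)
pose F A (x : T) : R := if A \in run c k then b A * \1_A x else 0.
rewrite (_ : step k b = fun x => \sum_(A <- run c k) F A x); last first.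
  by apply/funext => x; rewrite /step big_seq big_mkcond.
apply: measurable_sum => A; rewrite /F; case: (A \in run c k) / boolP => // Ak.
apply: measurable_funM => //; apply: measurable_indic; exact: run_measurable Ak.
Qed.

Lemma integral_run_part k A (f : T -> R) : measurable_fun Omega f ->
  A \in run c k ->
  (\int[mu]_(x in A) (f x)%:E =
   \sum_(l < nparts G A (c A)) \int[mu]_(x in part G A (c A) l) (f x)%:E)%E.
Proof.
move=> mf Ak; have [tA AE _] := run_part Ak.
have AE' : A = \big[setU/set0]_(l < nparts G A (c A)) part G A (c A) l.
  by rewrite {1}AE -bigcup_mkord.
rewrite {1}AE' integral_bigsetU_EFin//.
- move=> l; apply: (@run_measurable k.+1); apply/mem_runS.
  by exists A, l; split.
- exact: index_enum_uniq.
- by move=> i j _ _ ij; apply/val_inj/(tA _ _ _ _ ij) => /=.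
- rewrite -AE'; apply/measurable_EFinP; apply: measurable_funS mf.
    exact: measurable_Omega.
  exact: run_sub Ak.
Qed.

Lemma integral_run k (f : T -> R) : measurable_fun Omega f ->
  (\int[mu]_(x in Omega) (f x)%:E = \sum_(A <- run c k) \int[mu]_(x in A) (f x)%:E)%E.
Proof.
move=> mf; elim: k => [|k IH]; first by rewrite big_seq1.
rewrite big_run IH big_seq [RHS]big_seq; apply: eq_bigr => A Ak.
exact: (integral_run_part mf Ak).
Qed.

End run.
(** * Step functions on the cells are dense in L1 *)

Lemma cvge_near_lt (R : realType) (u : (\bar R)^nat) : u @ \oo --> 0%E ->
  forall eps : R, 0 < eps -> \forall n \near \oo, (u n < eps%:E)%E.
Proof.
by move=> u0 eps eps0; apply: (u0 [set x | (x < eps%:E)%E]); exact: open_ereal_lt'.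
Qed.

(** * Approximation of sets in measure by algebras depending on n *)

Section approximable.
Context d (T : measurableType d) (R : realType) (mu : {measure set T -> \bar R}).
Variable Omega : set T.
Hypothesis mOmega : measurable Omega.
Hypothesis finOmega : (mu Omega < +oo)%E.
Implicit Types (A B C D E F : set T).

Definition sym_dist E F := mu (Omega `&` ((E `\` F) `|` (F `\` E))).

Let mY E F : measurable E -> measurable F ->
  measurable (Omega `&` ((E `\` F) `|` (F `\` E))).
Proof.
by move=> mE mF; apply: measurableI => //; apply: measurableU; exact: measurableD.
Qed.

Lemma sym_dist_triangle E F D : measurable E -> measurable F -> measurable D ->
  (sym_dist E D <= sym_dist E F + sym_dist F D)%E.
Proof.
move=> mE mF mD; apply: le_trans (measureU2 _ (mY mE mF) (mY mF mD)).
apply: le_measure; rewrite ?inE; [exact: mY|by apply: measurableU; exact: mY|].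
move=> x [Ox h]; have [Fx|Fx] := pselect (F x).
- by case: h => -[? ?]; [right|left]; split=> //; [left|right].
- by case: h => -[? ?]; [left|right]; split=> //; [left|right].
Qed.

Lemma sym_distU E F C D : measurable E -> measurable F -> measurable C ->
  measurable D ->
  (sym_dist (E `|` F) (C `|` D) <= sym_dist E C + sym_dist F D)%E.
Proof.
move=> mE mF mC mD; apply: le_trans (measureU2 _ (mY mE mC) (mY mF mD)).
apply: le_measure; rewrite ?inE.
- by apply: mY; exact: measurableU.
- by apply: measurableU; exact: mY.
move=> x [Ox [[[?|?] /not_orP[? ?]]|[[?|?] /not_orP[? ?]]]].
- by left; split=> //; left.
- by right; split=> //; left.
- by left; split=> //; right.
- by right; split=> //; right.
Qed.

Lemma sym_distC E F : sym_dist (~` E) (~` F) = sym_dist E F.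
Proof.
by rewrite /sym_dist !setDE !setCK setUC [E `&` _]setIC [F `&` _]setIC.
Qed.

(** Inside [Omega] the differences decrease to the empty set, and finiteness of [mu Omega] gives
    continuity from above. *)
Lemma sym_dist_bigcup (F : (set T)^nat) (eps : R) :
  (forall n, measurable (F n)) -> (forall n, F n `<=` F n.+1) -> 0 < eps ->
  exists N, forall n, (N <= n)%N -> (sym_dist (\bigcup_n F n) (F n) < eps%:E)%E.
Proof.
move=> mF ndF eps0; pose D n := Omega `&` ((\bigcup_n F n) `\` F n).
have mU : measurable (\bigcup_n F n) by exact: bigcupT_measurable.
have mD n : measurable (D n) by apply: measurableI => //; exact: measurableD.
have D0 : \bigcap_n D n = set0.
  rewrite -subset0 => x h; have [_ [[n _ Fnx] _]] := h 0%N I.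
  by have [_ [_]] := h n I; exact.
have : mu (D n) @[n --> \oo] --> mu (\bigcap_n D n).
  apply: nonincreasing_cvg_mu => //.
  - by rewrite (le_lt_trans _ finOmega)// le_measure ?inE// => x [].
  - by rewrite D0.
  - apply/nonincreasing_seqP => n; rewrite subsetEset => x [Ox [Ux nF]].
    by split=> //; split=> // /ndF.
rewrite D0 measure0 => /cvge_near_lt/(_ eps eps0)[N _ HN].
exists N => n /HN; rewrite /sym_dist [F n `\` _](_ : _ = set0) ?setU0//.
by apply/seteqP; split=> // x [Fnx]; apply; exists n.
Qed.

Variable S : nat -> set (set T).
Hypothesis S_measurable : forall n C, S n C -> measurable C.
Hypothesis S0 : forall n, S n set0.
Hypothesis SC : forall n C, S n C -> S n (~` C).
Hypothesis SU : forall n C D, S n C -> S n D -> S n (C `|` D).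

(** The algebras [S n] are not assumed nested. Asking for an approximant at every large [n] lets two
    sets be approximated in the same [S n], where their union can be formed. *)
Definition approximable E := measurable E /\ forall eps : R, 0 < eps ->
  exists N, forall n, (N <= n)%N -> exists2 C, S n C & (sym_dist E C < eps%:E)%E.

Lemma sym_dist_approximable E : measurable E ->
  (forall eps : R, 0 < eps ->
    exists2 F, approximable F & (sym_dist E F < eps%:E)%E) ->
  approximable E.
Proof.
move=> mE h; split=> // eps eps0.
have eps20 : 0 < eps / 2 by rewrite divr_gt0.
have [F [mF aF] EF] := h _ eps20; have [N HN] := aF _ eps20.
exists N => n /HN[C SnC FC]; exists C => //.
have mC := S_measurable SnC.
apply: le_lt_trans (sym_dist_triangle mE mF mC) _.
by rewrite [eps]splitr EFinD lteD.
Qed.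

Lemma approximable_setC E : approximable E -> approximable (~` E).
Proof.
move=> [mE aE]; split=> [|eps /aE[N HN]]; first exact: measurableC.
exists N => n /HN[C SnC EC]; exists (~` C); first exact: SC.
by rewrite sym_distC.
Qed.

Lemma approximable_setU E F :
  approximable E -> approximable F -> approximable (E `|` F).
Proof.
move=> [mE aE] [mF aF]; split=> [|eps eps0]; first exact: measurableU.
have eps20 : 0 < eps / 2 by rewrite divr_gt0.
have [N1 H1] := aE _ eps20; have [N2 H2] := aF _ eps20.
exists (maxn N1 N2) => n; rewrite geq_max => /andP[/H1[C SnC EC] /H2[D SnD FD]].
exists (C `|` D); first exact: SU.
have mC := S_measurable SnC; have mD := S_measurable SnD.
apply: le_lt_trans (sym_distU mE mF mC mD) _.
by rewrite [eps]splitr EFinD lteD.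
Qed.

Lemma approximable_set0 : approximable set0.
Proof.
split=> // eps eps0; exists 0%N => n _; exists set0 => //.
by rewrite /sym_dist setDv setUid setI0 measure0 lte_fin.
Qed.

(** Each [S n] is closed under finite unions only, so a countable union is reached as a limit in
    measure of finite ones. *)
Lemma approximable_bigcup (F : (set T)^nat) :
  (forall n, approximable (F n)) -> approximable (\bigcup_n F n).
Proof.
move=> aF; pose G n := \big[setU/set0]_(i < n) F i.
have aG n : approximable (G n).
  rewrite /G; elim/big_ind : _ => //; first exact: approximable_set0.
  exact: approximable_setU.
have GF : \bigcup_n G n = \bigcup_n F n.
  apply/seteqP; split=> x [n _].
    by rewrite /G -bigcup_mkord => -[i _ Fix]; exists i.
  by move=> Fnx; exists n.+1 => //; rewrite /G big_ord_recr; right.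
rewrite -GF; apply: sym_dist_approximable => [|eps eps0].
  by apply: bigcupT_measurable => n; case: (aG n).
have [||//|N HN] := @sym_dist_bigcup G eps.
- by move=> n; case: (aG n).
- by move=> n x; rewrite /G big_ord_recr; left.
by exists (G N); [exact: aG|exact: HN].
Qed.

Lemma sigma_algebra_approximable : sigma_algebra setT approximable.
Proof.
split; first exact: approximable_set0.
- by move=> A; rewrite setTD; exact: approximable_setC.
- exact: approximable_bigcup.
Qed.

End approximable.

(** * Approximation of measurable sets within a rectangle *)

Section rectangle.
Context (R : realType) (p : nat).
Notation T := (p.-tuple R).
Notation mu := (lebesgue R p).
Implicit Types (I : 'I_p -> interval R).

Lemma measurable_box (U : 'I_p -> set R) : (forall i, measurable (U i)) ->
  measurable [set x : T | forall i, U i (tnth x i)].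
Proof.
move=> mU; rewrite (_ : mkset _ =
    \bigcap_(i in [set: 'I_p]) ((fun x : T => tnth x i) @^-1` U i)).
  apply: fin_bigcap_measurable => // i _; rewrite -[X in measurable X]setTI.
  exact: measurable_tnth.
by apply/seteqP; split => y /= h i; [move=> _|]; exact: h.
Qed.

Lemma measurable_rectangle I : measurable (rectangle I : set T).
Proof.
by apply: (@measurable_box (fun i => [set` I i])) => i; exact: measurable_itv.
Qed.

Lemma open_box (U : 'I_p -> set R) : (forall i, open (U i)) ->
  open_tuple [set x : T | forall i, U i (tnth x i)].
Proof.
move=> oU; rewrite /open_tuple (_ : mkset _ =
    \big[setI/setT]_(i < p) ((fun v : 'rV[R]_p => v ord0 i) @^-1` U i)).
  elim/big_ind : _ => [|A B|i _]; [exact: openT|exact: openI|].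
  by apply: open_comp => // v _; exact: coord_continuous.
rewrite -bigcap_seq; apply/seteqP; split=> v /= h i.
  by move=> _; have := h i; rewrite tnth_mktuple.
by rewrite tnth_mktuple; apply: h; rewrite /= mem_index_enum.
Qed.

Lemma rectangle_lty I : (forall i, bounded_set [set` I i]) ->
  (mu (rectangle I) < +oo)%E.
Proof.
move=> bI; rewrite /rectangle (@lebesgue_box _ _ (fun i => [set` I i])); last first.
  by move=> i; exact: measurable_itv.
have fI i : (lebesgue_measure [set` I i] < +oo)%E.
  have [M [Mr MP]] := bI i.
  have MI : [set` I i] `<=` `[- (M + 1), M + 1]%classic.
    move=> x xI; have := MP (M + 1) _ x xI; rewrite ltrDl ltr01 => /(_ isT).
    by rewrite /= in_itv/= ler_norml.
  apply: (@le_lt_trans _ _ (lebesgue_measure `[- (M + 1), M + 1]%classic)).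
    by apply: le_measure => //; rewrite inE; exact: measurable_itv.
  by rewrite lebesgue_measure_itv/=; case: ifP => // _; rewrite -EFinB ltry.
rewrite -ge0_fin_numE; last first.
  by elim/big_ind : _ => // x y x0 y0; exact: mule_ge0.
elim/big_ind : _ => // [x y|i _]; first exact: fin_numM.
by rewrite ge0_fin_numE.
Qed.

(** The interior of the interval: the approximation hypothesis concerns open subsets of [Omega],
    while the sides of [Omega] may contain their end points. *)
Definition open_bounds (i : interval R) : interval R :=
  let: Interval a b := i in
  Interval (if a is BSide _ x then BSide false x else a)
           (if b is BSide _ x then BSide true x else b).

Lemma open_bounds_sub i : [set` open_bounds i] `<=` [set` i].
Proof.
move=> x /=; apply: subitvP.
by move: i => [[[] a|[]] [[] b|[]]]; rewrite subitvE /= ?bnd_simp ?lexx.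
Qed.

Lemma lebesgue_measure_open_bounds i :
  lebesgue_measure [set` open_bounds i] = lebesgue_measure ([set` i] : set R).
Proof. by move: i => [[[] a|[]] [[] b|[]]]; rewrite !lebesgue_measure_itv. Qed.

Lemma open_open_bounds i : open [set` open_bounds i].
Proof. by move: i => [[[] a|[]] [[] b|[]]]; exact: interval_open. Qed.

(** Lengths of intervals ignore end points, so both rectangles have the same finite volume and their
    difference is null. *)
Lemma rectangle_boundary I : (mu (rectangle I) < +oo)%E ->
  mu (rectangle I `\` rectangle (open_bounds \o I)) = 0%E.
Proof.
move=> fI.
have mI J : measurable (rectangle J : set T).
  exact: measurable_rectangle.
have JI : rectangle (open_bounds \o I) `<=` rectangle I.
  by move=> x h i; apply: open_bounds_sub; exact: h.
have JE : mu (rectangle (open_bounds \o I)) = mu (rectangle I).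
  rewrite /rectangle (@lebesgue_box _ _ (fun i => [set` I i])); last first.
    by move=> i; exact: measurable_itv.
  rewrite (@lebesgue_box _ _ (fun i => [set` open_bounds (I i)])); last first.
    by move=> i; exact: measurable_itv.
  by apply: eq_bigr => i _; exact: lebesgue_measure_open_bounds.
rewrite measureD//= setIidr// JE subee//.
by rewrite ge0_fin_numE.
Qed.

Section approximable.
Variable I : 'I_p -> interval R.
Notation Omega := (rectangle I).
Hypothesis fI : (mu Omega < +oo)%E.
Variable S : nat -> set (set T).
Hypothesis S_measurable : forall n C, S n C -> measurable C.
Hypothesis S0 : forall n, S n set0.
Hypothesis SC : forall n C, S n C -> S n (~` C).
Hypothesis SU : forall n C D, S n C -> S n D -> S n (C `|` D).
Hypothesis S_open : forall B : set T, open_tuple B -> B `<=` Omega ->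
  exists Bn : nat -> set T,
    [/\ forall n, Bn n `<=` Bn n.+1, \bigcup_n Bn n = B & forall n, S n (Bn n)].

Let mOmega : measurable (Omega : set T).
Proof. exact: measurable_rectangle. Qed.

Lemma approximable_open B : open_tuple B -> B `<=` Omega ->
  approximable mu Omega S B.
Proof.
move=> oB BO; have [Bn [ndB <- SB]] := S_open oB BO.
have mB n : measurable (Bn n) := S_measurable (SB n).
split=> [|eps eps0]; first exact: bigcupT_measurable.
have [N HN] := sym_dist_bigcup mOmega fI mB ndB eps0.
by exists N => n /HN ?; exists (Bn n).
Qed.

(** The approximable sets form a sigma-algebra, so it suffices to treat the generators: preimages
    under a coordinate of Borel sets of R, and among these, by the same principle, of open
    intervals. *)
Lemma approximable_measurable E : measurable E -> approximable mu Omega S E.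
Proof.
have sA := sigma_algebra_approximable mOmega fI S_measurable S0 SC SU.
apply: smallest_sub => // A.
rewrite -bigcup_seq/= => -[i _ [Y mY <-]]; rewrite setTI.
have {}mY : (@RGenOpens.G R).-sigma.-measurable Y.
  by rewrite -RGenOpens.measurableE.
pose C : set (set R) :=
  [set Y | approximable mu Omega S ((fun x : T => tnth x i) @^-1` Y)].
suff : C Y by [].
move: Y mY; apply: smallest_sub.
  have [s0 sC sU] := sA; split.
  - by rewrite /C/= preimage_set0.
  - by move=> Y; rewrite /C/= setTD preimage_setC -setTD; exact: sC.
  - by move=> F CF; rewrite /C/= preimage_bigcup; exact: sU.
move=> _ [a [b ->]].
(* The slab over []a, b[] is not contained in [Omega]; it is cut down to an open box in the
   interior, from which it differs inside [Omega] by boundary points only. *)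
pose U j : set R := [set` open_bounds (I j)] `&`
  (if j == i then `]a, b[%classic else setT).
pose B : set T := [set x | forall j, U j (tnth x j)].
have oB : open_tuple B.
  apply: open_box => j; apply: openI; first exact: open_open_bounds.
  by case: ifP => _; [exact: interval_open|exact: openT].
have BO : B `<=` Omega.
  by move=> x Bx j; apply: open_bounds_sub; case: (Bx j).
have aB := approximable_open oB BO.
have mE : measurable ((fun x : T => tnth x i) @^-1` `]a, b[).
  by rewrite -[X in measurable X]setTI; apply: measurable_tnth.
apply: (sym_dist_approximable mOmega S_measurable) => // eps eps0.
exists B => //; apply: le_lt_trans (_ : (0 < _)%E); last by rewrite lte_fin.
rewrite -(rectangle_boundary fI) le_measure ?inE//.
- by apply: measurableI => //; apply: measurableU; apply: measurableD => //; case: aB.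
- apply: measurableD => //; exact: measurable_rectangle.
move=> x [Ox h]; split=> // OJx; case: h => -[].
  move=> xab; apply => j; split; first exact: OJx.
  by case: eqVneq => // ->.
by move=> /(_ i)[_]; rewrite eqxx.
Qed.
End approximable.
End rectangle.

(** * L1 distance, cell averages and density of step functions *)

Section L1_distance.
Context d (T : measurableType d) (R : realType) (mu : {measure set T -> \bar R}).
Variable D : set T.
Hypothesis mD : measurable D.
Implicit Types f g h s t : T -> R.

Definition L1_dist f g : \bar R := (\int[mu]_(x in D) `|f x - g x|%:E)%E.

Let mN f g : measurable_fun D f -> measurable_fun D g ->
  measurable_fun D (fun x => `|f x - g x|%:E).
Proof.
move=> mf mg; apply/measurable_EFinP; apply: measurableT_comp => //.
exact: measurable_funB.
Qed.

Lemma L1_dist_triangle f g h : measurable_fun D f -> measurable_fun D g ->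
  measurable_fun D h -> (L1_dist f h <= L1_dist f g + L1_dist g h)%E.
Proof.
move=> mf mg mh; rewrite /L1_dist -ge0_integralD//; last 2 first.
- exact: mN.
- exact: mN.
apply: ge0_le_integral => //; [exact: mN|by apply: emeasurable_funD; exact: mN|].
by move=> x _; rewrite -EFinD lee_fin ler_distD.
Qed.

Lemma L1_dist_add f g s t : measurable_fun D f -> measurable_fun D g ->
  measurable_fun D s -> measurable_fun D t ->
  (L1_dist (fun x => f x + g x)%R (fun x => s x + t x)%R
   <= L1_dist f s + L1_dist g t)%E.
Proof.
move=> mf mg ms mt; rewrite /L1_dist -ge0_integralD//; last 2 first.
- exact: mN.
- exact: mN.
apply: ge0_le_integral => //.
- by apply: mN; exact: measurable_funD.
- by apply: emeasurable_funD; exact: mN.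
by move=> x _; rewrite -EFinD lee_fin opprD addrACA ler_normD.
Qed.

Lemma L1_dist_scale (r : R) f s : measurable_fun D f -> measurable_fun D s ->
  L1_dist (fun x => r * f x)%R (fun x => r * s x)%R = (`|r|%:E * L1_dist f s)%E.
Proof.
move=> mf ms; rewrite /L1_dist -ge0_integralZl//; last exact: mN.
by apply: eq_integral => x _; rewrite -EFinM -normrM mulrBr.
Qed.

(** The distance between the constants [b] and the mean is the modulus of the integral of [f - b],
    hence at most the distance from [f] to [b]; the triangle inequality yields the factor 2. *)
Lemma L1_dist_average f (b : R) : (0 < mu D < +oo)%E ->
  mu.-integrable D (EFin \o f) ->
  (L1_dist f (cst (fine (\int[mu]_(x in D) (f x)%:E) / fine (mu D))%R)
   <= 2%:E * L1_dist f (cst b))%E.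
Proof.
move=> /andP[D0 Doo] fi.
have mf : measurable_fun D f by apply/measurable_EFinP; exact: measurable_int fi.
set m := fine (mu D); have mE : mu D = m%:E by rewrite fineK// ge0_fin_numE.
have m0 : 0 < m by rewrite fine_gt0// D0.
set a := fine _; have aE : (\int[mu]_(x in D) (f x)%:E = a%:E)%E.
  by rewrite fineK//; exact: integrable_fin_num.
apply: (@le_trans _ _ (L1_dist f (cst b) + L1_dist (cst b) (cst (a / m)%R))%E).
  exact: L1_dist_triangle.
suff : (L1_dist (cst b) (cst (a / m)%R) <= L1_dist f (cst b))%E.
  by move=> h; rewrite mule_natl mule2n leeD2l.
rewrite {1}/L1_dist/= integral_cst// mE -EFinM.
have -> : `|b - a / m| * m = `|a - b * m|.
  by rewrite -{2}(gtr0_norm m0) -normrM mulrBl divfK ?gt_eqF// distrC.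
have bi : mu.-integrable D (EFin \o cst b).
  apply/integrableP; split; first exact/measurable_EFinP.
  rewrite [X in (X < _)%E](_ : _ = \int[mu]_(x in D) cst `|b|%:E x)%E//.
  by rewrite integral_cst// mE -EFinM ltry.
have -> : `|a - b * m|%:E = `|\int[mu]_(x in D) (f x - b)%:E|%E.
  rewrite -abse_EFin EFinB EFinM -aE -mE -(integral_cst mu mD).
  by rewrite -integralB_EFin.
apply: le_abse_integral => //; apply/measurable_EFinP.
exact: measurable_funB.
Qed.

End L1_distance.

Section run_density.
Context (R : realType) (p : nat).
Notation T := (p.-tuple R).
Notation mu := (lebesgue R p).
Variables (Omega : set T) (G : scheme R T).
Hypothesis vG : valid_scheme Omega G.
Hypothesis finOmega : (mu Omega < +oo)%E.
Let mOmega := measurable_Omega vG.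
Local Notation run := (run Omega G).
Local Notation step := (step Omega G).
Local Notation L1_dist := (L1_dist mu Omega).

Section fixed_run.
Variable c : set T -> nat.
Hypothesis c_lt : forall k A, elementary Omega G k A -> (c A < nways G A)%N.

Lemma measurable_step_Omega k b : measurable_fun Omega (step c k b).
Proof. exact: (measurable_funTS (measurable_step vG c_lt k b)). Qed.

Lemma run_fin_num k A : A \in run c k -> mu A \is a fin_num.
Proof.
move=> Ak; rewrite ge0_fin_numE// (le_lt_trans _ finOmega)// le_measure ?inE//.
  exact: (run_measurable vG c_lt Ak).
exact: (run_sub vG c_lt Ak).
Qed.

Lemma L1_dist_run k f b : measurable_fun Omega f ->
  L1_dist f (step c k b) =
  (\sum_(A <- run c k) \int[mu]_(x in A) `|f x - b A|%:E)%E.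
Proof.
move=> mf; rewrite /L1_dist (integral_run vG c_lt k); last first.
  apply: measurableT_comp => //; apply: measurable_funB => //.
  exact: measurable_step_Omega.
rewrite big_seq [RHS]big_seq; apply: eq_bigr => A Ak.
apply: eq_integral => x; rewrite inE => Ax.
by rewrite (step_cell vG c_lt b Ak Ax).
Qed.

Lemma L1_dist_step k b b' : L1_dist (step c k b) (step c k b') =
  (\sum_(A <- run c k) `|b A - b' A| * fine (mu A))%:E.
Proof.
rewrite L1_dist_run; last exact: measurable_step_Omega.
rewrite -sumEFin big_seq [RHS]big_seq; apply: eq_bigr => A Ak.
transitivity (\int[mu]_(x in A) (cst `|b A - b' A|%:E) x)%E.
  apply: eq_integral => x; rewrite inE => Ax.
  by rewrite (step_cell vG c_lt b Ak Ax).
rewrite integral_cst; last exact: (run_measurable vG c_lt Ak).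
by rewrite EFinM fineK// (run_fin_num Ak).
Qed.

Lemma L1_dist_run_average k f b : mu.-integrable Omega (EFin \o f) ->
  (L1_dist f (step c k (fun A =>
      fine (\int[mu]_(x in A) (f x)%:E) / fine (mu A))%R)
   <= 2%:E * L1_dist f (step c k b))%E.
Proof.
move=> fi; have mf : measurable_fun Omega f.
  by apply/measurable_EFinP; exact: measurable_int fi.
rewrite !L1_dist_run// ge0_sume_distrr; last first.
  by move=> A _; exact: integral_ge0.
rewrite big_seq [leRHS]big_seq; apply: lee_sum => A Ak.
have mA := run_measurable vG c_lt Ak.
have A0 : (0 < mu A < +oo)%E.
  by rewrite (run_measure_gt0 vG c_lt Ak) -ge0_fin_numE// (run_fin_num Ak).
have fA : mu.-integrable A (EFin \o f).
  by apply: integrableS fi => //; exact: (run_sub vG c_lt Ak).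
exact: (L1_dist_average mA (b A) A0 fA).
Qed.

End fixed_run.

Variable c : nat -> set T -> nat.
Hypothesis c_lt : forall n k A, elementary Omega G k A -> (c n A < nways G A)%N.

(** Inside [Omega] such a [C] is a union of cells of level [n]. Outside, only measurability is
    asked, so that complements in the whole space stay in the class. *)
Definition run_saturated n (C : set T) := measurable C /\
  forall A, A \in run (c n) n -> A `<=` C \/ A `&` C = set0.

Lemma run_saturated_measurable n C : run_saturated n C -> measurable C.
Proof. by case. Qed.

Lemma run_saturated0 n : run_saturated n set0.
Proof. by split=> // A _; right; rewrite setI0. Qed.

Lemma run_saturatedC n C : run_saturated n C -> run_saturated n (~` C).
Proof.
move=> [mC SC]; split=> [|A /SC[hC|hC]]; first exact: measurableC.
  by right; rewrite -setDE; apply/seteqP; split=> // x [/hC].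
by left=> x Ax Cx; have : (A `&` C) x by []; rewrite hC.
Qed.

Lemma run_saturatedU n C D :
  run_saturated n C -> run_saturated n D -> run_saturated n (C `|` D).
Proof.
move=> [mC SC] [mD SD]; split=> [|A An]; first exact: measurableU.
have [hC|hC] := SC A An; first by left => x /hC; left.
have [hD|hD] := SD A An; first by left => x /hD; right.
by right; rewrite setIUr hC hD setU0.
Qed.

Hypothesis run_approximable : forall E, measurable E ->
  approximable mu Omega run_saturated E.

Definition step_dense f := measurable_fun Omega f /\
  forall eps : R, 0 < eps -> exists N, forall n, (N <= n)%N ->
    exists b, (L1_dist f (step (c n) n b) < eps%:E)%E.

Lemma step_dense_indic E : measurable E -> step_dense \1_E.
Proof.
move=> mE; split=> [|eps eps0]; first exact: measurable_indic.
have [_ /(_ _ eps0)[N HN]] := run_approximable mE.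
(* On [Omega] the step function with these coefficients is the indicator of the saturated set [C],
   so the L1 distance becomes the measure of a symmetric difference. *)
exists N => n /HN[C [mC SC] EC]; exists (fun A => `[< A `<=` C >]%:R).
move: EC; rewrite /sym_dist setIC => EC.
have mEC : measurable ((E `\` C) `|` (C `\` E)).
  by apply: measurableU; exact: measurableD.
rewrite /L1_dist; under eq_integral.
  move=> x; rewrite inE => Ox.
  have -> : `|\1_E x - step (c n) n (fun A => `[< A `<=` C >]%:R) x| =
      \1_((E `\` C) `|` (C `\` E)) x :> R.
    have [A An [Ax ->]] := run_cell vG (c_lt n) n Ox.
    have -> : `[< A `<=` C >] = (x \in C).
      apply/asboolP/idP => [hC|]; first by rewrite inE; exact: hC.
      rewrite inE => Cx; have [//|hC] := SC A An.
      by have : (A `&` C) x by []; rewrite hC.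
    rewrite !indicE in_setU !in_setD.
    by case: (x \in E); case: (x \in C); rewrite /= ?subrr ?subr0 ?sub0r ?normr0 ?normrN ?normr1.
  over.
by rewrite integral_indic.
Qed.

Lemma step_dense_add f g : step_dense f -> step_dense g ->
  step_dense (fun x => f x + g x).
Proof.
move=> [mf df] [mg dg]; split=> [|eps eps0]; first exact: measurable_funD.
have eps20 : 0 < eps / 2 by rewrite divr_gt0.
have [N1 H1] := df _ eps20; have [N2 H2] := dg _ eps20.
exists (maxn N1 N2) => n; rewrite geq_max => /andP[/H1[b1 h1] /H2[b2 h2]].
exists (fun A => b1 A + b2 A).
have -> : step (c n) n (fun A => b1 A + b2 A) =
    fun x => step (c n) n b1 x + step (c n) n b2 x.
  by apply/funext => x; exact: step_add.
have mb b := measurable_step_Omega (c_lt n) n b.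
apply: le_lt_trans (L1_dist_add mu mOmega mf mg (mb b1) (mb b2)) _.
by rewrite [eps]splitr EFinD lteD.
Qed.

Lemma step_dense_scale (r : R) f : step_dense f -> step_dense (fun x => r * f x).
Proof.
move=> [mf df]; split=> [|eps eps0]; first exact: measurable_funM.
have r0 : 0 < `|r| + 1 by rewrite ltr_pwDr.
have [N HN] := df (eps / (`|r| + 1)) (divr_gt0 eps0 r0).
exists N => n /HN[b hb]; exists (fun A => r * b A).
have -> : step (c n) n (fun A => r * b A) = fun x => r * step (c n) n b x.
  by apply/funext => x; exact: step_scale.
rewrite (L1_dist_scale mu mOmega r mf (measurable_step_Omega (c_lt n) n b)).
apply: (@le_lt_trans _ _ (`|r| * (eps / (`|r| + 1)))%:E).
  by rewrite EFinM lee_wpmul2l// ltW.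
by rewrite lte_fin mulrA ltr_pdivrMr// mulrC ltr_pM2l// ltrDl.
Qed.

Import HBSimple.

Lemma step_dense_sfun (g : {sfun T >-> R}) : step_dense g.
Proof.
pose h (s : seq R) x := \sum_(y <- s) y * \1_(g @^-1` [set y]) x.
have -> : (g : T -> R) = h (finmap.enum_fset (fset_set (range g))).
  by apply/funext => x; rewrite [LHS]fimfunE fsbig_finite.
elim: (finmap.enum_fset _) => [|y s IH].
  rewrite (_ : h [::] = fun x => 0 * \1_(set0 : set T) x).
    by apply: step_dense_scale; exact: step_dense_indic.
  by apply/funext => x; rewrite /h big_nil mul0r.
rewrite (_ : h (y :: s) = fun x => y * \1_(g @^-1` [set y]) x + h s x).
  by apply: step_dense_add => //; apply: step_dense_scale; exact: step_dense_indic.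
by apply/funext => x; rewrite /h big_cons.
Qed.

Lemma step_dense_integrable f : mu.-integrable Omega (EFin \o f) -> step_dense f.
Proof.
move=> fi; have mf : measurable_fun Omega f.
  by apply/measurable_EFinP; exact: measurable_int fi.
split=> // eps eps0; have eps20 : 0 < eps / 2 by rewrite divr_gt0.
have [g [_ _ /cvge_near_lt/(_ _ eps20)[m _ /(_ m (leqnn m)) Hm]]] :=
  approximation_sfun_integrable mOmega fi.
have [mg /(_ _ eps20)[N HN]] := step_dense_sfun (g m).
exists N => n /HN[b hb]; exists b.
have mb := measurable_step_Omega (c_lt n) n b.
apply: le_lt_trans (L1_dist_triangle mu mOmega mf mg mb) _.
by rewrite [eps]splitr EFinD lteD.
Qed.

End run_density.
Section rectangle_density.
Context (R : realType) (p : nat).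
Notation T := (p.-tuple R).
Notation mu := (lebesgue R p).

(** The regions composing [Bn n] are cells of levels at most [n] of a single run. By [run_nested]
    each cell of level [n] lies inside such a region or misses it, hence the saturation. *)
Lemma generates_saturated (Omega : set T) (G : scheme R T) :
  valid_scheme Omega G -> generates_open_sets Omega G ->
  exists2 c : nat -> set T -> nat,
    forall n k A, elementary Omega G k A -> (c n A < nways G A)%N &
    forall B : set T, open_tuple B -> B `<=` Omega ->
      exists Bn : nat -> set T, [/\ forall n, Bn n `<=` Bn n.+1,
        \bigcup_n Bn n = B & forall n, run_saturated Omega G c n (Bn n)].
Proof.
move=> vG [c0 Hc0].
(* A region A with c0 n A >= nways G A is a leaf of the run c0 n; splitting it
   in an arbitrary way only refines the partition. *)
pose c n A := if (c0 n A < nways G A)%N then c0 n A else 0%N.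
have c_lt n k A : elementary Omega G k A -> (c n A < nways G A)%N.
  by rewrite /c => /vG[_ _ w0 _ _]; case: ifP.
have region_run n k A :
    region Omega G (fun A' j => j = c0 n A') k A -> A \in run Omega G (c n) k.
  elim=> [|{}k {}A j l _ IH jA jE lA]; first by rewrite inE.
  by apply/mem_runS; exists A, l; rewrite /c -jE jA; split.
exists c => // B oB BO; have [Bn [ndB UB HB]] := Hc0 B oB BO.
exists Bn; split=> // n; have [D [HD _ ->]] := HB n.
have DE A : A \in D -> exists2 k, (k <= n)%N & A \in run Omega G (c n) k.
  by move=> /HD[k /andP[_ kn] /region_run]; exists k.
split.
  rewrite bigcup_seq big_seq; elim/big_ind : _ => // [A A' mA mA'|A].
    exact: measurableU.
  by move=> /DE[k _ Ak]; exact: (run_measurable vG (c_lt n) Ak).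
move=> A An; have [[A' A'D AA']|h] := pselect (exists2 A', A' \in D & A `<=` A').
  by left=> x Ax; exists A' => //; exact: AA'.
right; rewrite -subset0 => x [Ax [A' /= A'D A'x]].
have [k kn A'k] := DE _ A'D.
have An' : A \in run Omega G (c n) ((n - k) + k) by rewrite subnK.
have [AA'|AA'] := run_nested vG (c_lt n) A'k An'; first by case: h; exists A'.
by have : (A `&` A') x by []; rewrite AA'.
Qed.

Lemma run_average_dense (I : 'I_p -> interval R) (G : scheme R T) (f : T -> R)
    (eps : R) :
  let Omega := rectangle I in
  (mu Omega < +oo)%E -> valid_scheme Omega G -> generates_open_sets Omega G ->
  mu.-integrable Omega (EFin \o f) -> 0 < eps ->
  exists c n, (forall k A, elementary Omega G k A -> (c A < nways G A)%N) /\
    (L1_dist mu Omega f (step Omega G c n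
      (fun A => fine (\int[mu]_(x in A) (f x)%:E) / fine (mu A))%R) < eps%:E)%E.
Proof.
move=> Omega fin vG gG fi eps0.
have [c c_lt HS] := generates_saturated vG gG.
have aE := approximable_measurable fin (@run_saturated_measurable _ _ _ _ c)
  (@run_saturated0 _ _ _ _ c) (@run_saturatedC _ _ _ _ c)
  (@run_saturatedU _ _ _ _ c) HS.
(* Half of [eps] pays for the factor 2 lost in passing to averages. *)
have eps20 : 0 < eps / 2 by rewrite divr_gt0.
have [_ /(_ _ eps20)[n /(_ n (leqnn n))[b hb]]] :=
  step_dense_integrable vG c_lt aE fi.
exists (c n), n; split; first exact: c_lt.
apply: le_lt_trans (L1_dist_run_average vG fin (c_lt n) n b fi) _.
have -> : eps%:E = (2%:E * (eps / 2)%:E)%E by rewrite -EFinM mulrC divfK.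
by rewrite lte_pmul2l.
Qed.

End rectangle_density.
(** * Following a run with positive probability *)

(* No measurability is needed because the integral of a nonnegative function is
   a supremum over the simple functions below it. *)
Lemma le_integral_nonmeasurable d (T : measurableType d) (R : realType)
    (mu : {measure set T -> \bar R}) (D : set T) (f g : T -> \bar R) :
  (forall x, D x -> 0 <= f x)%E -> (forall x, D x -> f x <= g x)%E ->
  (\int[mu]_(x in D) f x <= \int[mu]_(x in D) g x)%E.
Proof.
move=> f0 fg; have g0 x : D x -> (0 <= g x)%E.
  by move=> Dx; exact: le_trans (f0 x Dx) (fg x Dx).
rewrite !ge0_integralE//; apply: le_ereal_sup => _ [h hf <-].
exists h => // x; apply: le_trans (hf x) _.
by rewrite !patchE; case: ifPn => // /[!inE]; exact: fg.
Qed.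

Lemma measure_setD_null d (T : measurableType d) (R : realType)
    (mu : {measure set T -> \bar R}) (D N : set T) :
  measurable D -> measurable N -> mu N = 0%E -> (mu D <= mu (D `\` N))%E.
Proof.
move=> mD mN N0; rewrite -[leRHS]adde0 -N0.
apply: le_trans (measureU2 _ (measurableD mD mN) mN).
apply: le_measure; rewrite ?inE//; first by apply: measurableU => //; exact: measurableD.
by move=> x Dx; case: (pselect (N x)) => Nx; [right|left].
Qed.

(** Comparison is made with [C] times the indicator of the complement of [N], which is measurable
    even if [g] is not. On [N], where the bound may fail, the sign of [g] takes over. *)
Lemma integral_ge_ae_cst d (T : measurableType d) (R : realType)
    (mu : {measure set T -> \bar R}) (D N : set T) (g : T -> R) (C : R) :
  measurable D -> measurable N -> mu N = 0%E -> 0 <= C ->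
  (forall x, D x -> 0 <= g x) -> (forall x, D x -> ~ N x -> C <= g x) ->
  (C%:E * mu D <= \int[mu]_(x in D) (g x)%:E)%E.
Proof.
move=> mD mN N0 C0 g0 Cg.
apply: (@le_trans _ _ (\int[mu]_(x in D) (C * \1_(~` N) x)%:E)%E); last first.
  apply: le_integral_nonmeasurable => x Dx; rewrite lee_fin ?mulr_ge0//.
  rewrite indicE; case: (pselect (N x)) => Nx.
    by rewrite memNset ?mulr0 ?g0//; exact.
  by rewrite mem_set// mulr1 Cg.
under eq_integral do rewrite EFinM.
have mNC : measurable (~` N) by exact: measurableC.
rewrite ge0_integralZl//; last exact/measurable_EFinP/measurable_indic.
rewrite lee_wpmul2l// integral_indic//.
by rewrite setIC -setDE measure_setD_null.
Qed.

Section run_event.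
Context (R : realType) (p : nat).
Notation T := (p.-tuple R).
Variables (Omega : set T) (G : scheme R T).
Context d (Xi : measurableType d) (P : probability Xi R).
Variable V : draws P T.
Hypothesis vG : valid_scheme Omega G.
Variable c : set T -> nat.
Hypothesis c_lt : forall k A, elementary Omega G k A -> (c A < nways G A)%N.
Variables (t : set T -> nat -> R) (eps : R).

Definition near_target A : set ((nparts G A (c A)).-tuple R) :=
  [set x | \sum_(l < nparts G A (c A)) `|tnth x l - t A l| < eps].

(* For b = true the outcome is that every cell stops, whatever near_target is. *)
Definition step_event k (b : bool) : set Xi :=
  \bigcap_(A in [set` run Omega G c k]) outcome V k b (@near_target A).

Fixpoint follow k : set Xi :=
  if k is k'.+1 then follow k' `&` step_event k' false else setT.

Lemma measurable_near_target A : measurable (@near_target A).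
Proof.
have h : measurable_fun [set: (nparts G A (c A)).-tuple R]
    (fun x : (nparts G A (c A)).-tuple R =>
      \sum_(l < nparts G A (c A)) `|tnth x l - t A l|).
  apply: measurable_sum => l; apply: measurableT_comp => //.
  by apply: measurable_funB => //; exact: measurable_tnth.
have := h measurableT [set r | r < eps]; rewrite setTI; apply.
by rewrite -set_itvNyo; exact: measurable_itv.
Qed.

Lemma measurable_outcome k A b j (U : set ((nparts G A j).-tuple R)) :
  measurable U -> measurable (outcome V k b U).
Proof.
move=> mU.
have mstop x : measurable [set w | stop V k A w = x].
  by have := measurable_funPTI (stop V k A) (I : measurable [set x]).
rewrite /outcome; case: b; first exact: (mstop true).
have mway : measurable [set w | way V k A w = j].
  by have := measurable_funPTI (way V k A) (I : measurable [set j]).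
have mth : measurable [set w | U [tuple theta V k A j i w | i < nparts G A j]].
  rewrite -[X in measurable X]setTI.
  apply: (_ : measurable_fun setT
    (fun w => [tuple theta V k A j i w | i < nparts G A j])) => //.
  apply/measurable_fun_tnthP => i.
  rewrite (_ : _ \o _ = theta V k A j i); first exact: measurable_funPT.
  by apply/funext => w /=; rewrite tnth_mktuple.
rewrite (_ : mkset _ = [set w | stop V k A w = false] `&`
    ([set w | way V k A w = j] `&`
     [set w | U [tuple theta V k A j i w | i < nparts G A j]])).
  by apply: measurableI => //; apply: measurableI.
apply/seteqP; split=> w /=; first by move=> [/negbTE].
by move=> [/negbT ? [? ?]].
Qed.

Lemma measurable_step_event k b : measurable (step_event k b).
Proof.
rewrite /step_event bigcap_seq; elim/big_ind : _ => // [A B|A _].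
  exact: measurableI.
exact: (@measurable_outcome k A b (c A) _ (@measurable_near_target A)).
Qed.

Lemma measurable_follow k : measurable (follow k).
Proof.
elim: k => [|k IH]; first exact: measurableT.
exact: (measurableI _ _ IH (measurable_step_event k false)).
Qed.

Lemma follow_cells k w : follow k w -> cells Omega G V k w = run Omega G c k.
Proof.
elim: k => [//|k IH] /= [/IH Fk Ek]; rewrite Fk; congr flatten.
rewrite (_ : [seq A <- _ | _] = run Omega G c k).
  by apply/eq_in_map => A Ak; have [_ ->] := Ek A Ak.
by apply/all_filterP/allP => A Ak; have [] := Ek A Ak.
Qed.

Lemma follow_active k A : A \in run Omega G c k -> follow k `<=` active Omega G V k A.
Proof. by move=> Ak w /follow_cells; rewrite /active/= => ->. Qed.

(** [conditional_laws] conditions on events of the history, whose generators are outcomes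
    intersected with [active]. On [follow k] the cells of the run are active, so inserting [active]
    leaves the event unchanged. *)
Lemma history_follow k : history Omega G V k (follow k).
Proof.
have hI j A B : history Omega G V j A -> history Omega G V j B ->
    history Omega G V j (A `&` B).
  exact: (@measurableI _ (g_sigma_algebraType _)).
elim: k => [|k IH]; first exact: (@measurableT _ (g_sigma_algebraType _)).
have hk : history Omega G V k.+1 (follow k).
  move: IH; apply: sub_sigma_algebra2 => _ [i [A [s [j [U [ik mU ->]]]]]].
  by exists i, A, s, j, U; split => //; exact: ltnW.
rewrite /= /step_event.
(* The induction runs over the list of factors alone, any sublist of the cells, while [follow k]
   stays fixed. *)
have [s sE] : exists s, s = run Omega G c k by eexists.
rewrite -sE; have : {subset s <= run Omega G c k} by rewrite sE.
elim: s {sE} => [|A s IHs] sub.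
  rewrite (_ : [set` _] = set0) ?bigcap_set0 ?setIT//.
  by apply/seteqP; split.
rewrite (_ : _ `&` _ = (active Omega G V k A `&` outcome V k false (@near_target A)) `&`
   (follow k `&` \bigcap_(A in [set` s]) outcome V k false (@near_target A))).
  apply: hI; last by apply: IHs => B Bs; apply: sub; rewrite inE Bs orbT.
  apply: sub_sigma_algebra; exists k, A, false, (c A), (@near_target A).
  by split=> //; exact: measurable_near_target.
apply/seteqP; split=> w.
  move=> [Fw h]; split; last split=> //.
    split; first by apply: (follow_active _ Fw); apply: sub; rewrite mem_head.
    by apply: h; rewrite /= mem_head.
  by move=> B Bs; apply: h; rewrite /= inE Bs orbT.
move=> [[_ hA] [Fw h]]; split=> // B; rewrite /= inE => /predU1P[->//|Bs].
exact: h.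
Qed.

Variables (delta : R).
Hypothesis procV : optional_stopping_process Omega G V.
Hypothesis delta0 : 0 < delta.
Hypothesis rho_delta : {ae P, forall w, forall k A, active Omega G V k A w ->
  delta < rho V k A w < 1 - delta}.
Hypothesis selection_gt0 : forall k A, elementary Omega G k A ->
  0 < selection G A (c A).
Hypothesis eps0 : 0 < eps.
Hypothesis t_gt0 : forall k A l, A \in run Omega G c k ->
  (l < nparts G A (c A))%N -> 0 < t A l.
Hypothesis t_sum : forall k A, A \in run Omega G c k ->
  \sum_(l < nparts G A (c A)) t A l = 1.

Lemma dirichlet_near_target k A : A \in run Omega G c k ->
  0 < dirichlet (assignment G A (c A)) (@near_target A).
Proof.
move=> Ak; have [_ _ a0] := run_part vG c_lt Ak.
have t0 := t_gt0 Ak; have ts := t_sum Ak; rewrite /near_target.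
(* A region without parts is excluded because its empty sum of targets would equal 1. *)
case: (nparts G A (c A)) a0 t0 ts => [|m] a0 t0 ts.
  by move: ts; rewrite big_ord0 => /eqP; rewrite eq_sym oner_eq0.
exact: dirichlet_gt0.
Qed.

(** The conditional law expresses the probability as an integral over [F] of a finite product, and
    almost surely each factor exceeds a positive constant. One statement covers both the continuing
    steps and the final stop. *)
Lemma step_event_gt0 k b F : measurable F -> history Omega G V k F ->
  (forall A, A \in run Omega G c k -> F `<=` active Omega G V k A) ->
  (0 < P F)%E -> (0 < P (F `&` step_event k b))%E.
Proof.
move=> mF hF FA PF; have [adV lawV] := procV.
(* [conditional_laws] takes lists without repetition. *)
pose D := undup (run Omega G c k).
have DE A : (A \in D) = (A \in run Omega G c k) by rewrite mem_undup.
have -> : step_event k b = \bigcap_(A in [set` D]) outcome V k b (@near_target A).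
  by apply: eq_bigcap => //; split=> A; rewrite /= DE.
have := lawV k D F (fun=> b) c near_target (undup_uniq _) hF; rewrite /= => ->;
    last first.
  move=> A; rewrite DE => Ak; have eA := run_elementary c_lt Ak.
  by split; [|exact: FA|exact: c_lt eA|exact: measurable_near_target].
have [N [mN N0 NP]] := rho_delta.
(* The first bound serves stopping, as [rho > delta]; the second serves continuing, as
   [1 - rho > delta]. *)
pose q A := Num.min delta
  (delta * (selection G A (c A) * dirichlet (assignment G A (c A)) (@near_target A))).
have q0 A : A \in D -> 0 < q A.
  rewrite DE => Ak; rewrite lt_min delta0 mulr_gt0// mulr_gt0//.
    exact: (selection_gt0 (run_elementary c_lt Ak)).
  exact: (dirichlet_near_target Ak).
apply: (@lt_le_trans _ _ ((\prod_(A <- D) q A)%:E * P F)%E).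
  rewrite mule_gt0// lte_fin big_seq; apply: prodr_gt0 => A; exact: q0.
have sd0 A : A \in D ->
   0 <= selection G A (c A) * dirichlet (assignment G A (c A)) (@near_target A).
  rewrite DE => Ak; rewrite mulr_ge0// ltW//.
    exact: (selection_gt0 (run_elementary c_lt Ak)).
  exact: (dirichlet_near_target Ak).
apply: (integral_ge_ae_cst mF mN N0).
- by rewrite big_seq; apply: prodr_ge0 => A /q0/ltW.
- move=> w Fw; rewrite big_seq; apply: prodr_ge0 => A AD.
  have Ak : A \in run Omega G c k by rewrite -DE.
  (* The sign is needed on all of [F], so it comes from [rho_adapted], which holds at every active
     [w], and not from the almost sure bound. *)
  have [_ /(_ w (FA A Ak w Fw))/andP[r0 r1]] := adV k A (run_elementary c_lt Ak).
  rewrite /outcome_prob; case: b => //.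
  by rewrite mulr_ge0 ?subr_ge0// sd0.
- move=> w Fw Nw; rewrite big_seq [leRHS]big_seq; apply: ler_prod => A AD.
  have Ak : A \in run Omega G c k by rewrite -DE.
  rewrite (ltW (q0 A AD))/=.
  have /andP[r0 r1] : delta < rho V k A w < 1 - delta.
    apply: contrapT => h; apply: Nw; apply: NP => /(_ k A (FA A Ak w Fw)).
    exact: h.
  rewrite /outcome_prob /q; case: b.
    by rewrite ge_min (ltW r0).
  by rewrite ge_min ler_wpM2r ?orbT// ?sd0//; lra.
Qed.

Lemma follow_gt0 k : (0 < P (follow k))%E.
Proof.
elim: k => [|k IH]; first by rewrite probability_setT.
apply: step_event_gt0 => //; first exact: measurable_follow.
- exact: history_follow.
- by move=> A; exact: follow_active.
Qed.

Lemma follow_stop_gt0 k : (0 < P (follow k `&` step_event k true))%E.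
Proof.
apply: step_event_gt0; first exact: measurable_follow.
- exact: history_follow.
- by move=> A; exact: follow_active.
- exact: follow_gt0.
Qed.

End run_event.
(** * The random measure along a run *)

Section opt_measure_follow.
Context (R : realType) (p : nat).
Notation T := (p.-tuple R).
Notation mu := (lebesgue R p).
Variables (Omega : set T) (G : scheme R T).
Context d (Xi : measurableType d) (P : probability Xi R).
Variable V : draws P T.
Hypothesis vG : valid_scheme Omega G.
Hypothesis finOmega : (mu Omega < +oo)%E.
Variable c : set T -> nat.
Hypothesis c_lt : forall k A, elementary Omega G k A -> (c A < nways G A)%N.
Variables (t : set T -> nat -> R) (eps : R).
Local Notation follow := (follow Omega G V c t eps).
Local Notation step_event := (step_event Omega G V c t eps).

Lemma opt_measure_set0 k w : opt_measure Omega G V k w set0 = 0.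
Proof.
have u0 A : uniform_on A (set0 : set T) = 0.
  by rewrite /uniform_on setI0 measure0 mul0r.
elim: k => [|k IH] /=; first exact: u0.
by rewrite set0I IH add0r big1// => A _; rewrite big1// => l _; rewrite u0 mulr0.
Qed.

Lemma follow_stopped_part k w : follow k w -> stopped_part Omega G V k w = set0.
Proof.
elim: k => [//|k IH] [Fk Ek] /=; rewrite IH// set0U.
rewrite -subset0 => x [A [Ak sA] _]; rewrite (follow_cells Fk) in Ak.
by have [] := Ek A Ak; rewrite sA.
Qed.

(** Between cells of one level [uniform_on] is 0 or 1. Writing it as an indicator at a point of [B]
    turns sums over cells into values of [step]. *)
Lemma uniform_on_run k A B x : A \in run Omega G c k -> B \in run Omega G c k ->
  B x -> uniform_on A B = \1_A x.
Proof.
move=> Ak Bk Bx; rewrite /uniform_on indicE.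
have [xA|xA] := boolP (x \in A).
  have <- : A = B by apply: (run_disjoint vG c_lt Ak Bk _ Bx); rewrite inE in xA.
  rewrite setIid divff// gt_eqF// fine_gt0// (run_measure_gt0 vG c_lt Ak).
  by rewrite -ge0_fin_numE// (run_fin_num vG finOmega c_lt Ak).
rewrite [A `&` B](_ : _ = set0) ?measure0 ?mul0r// -subset0 => y [Ay By].
by move/negP : xA; apply; rewrite inE (run_disjoint vG c_lt Ak Bk Ay By).
Qed.

Lemma opt_measureS_follow k w B : follow k.+1 w ->
  opt_measure Omega G V k.+1 w B =
  \sum_(A <- run Omega G c k) \sum_(l < nparts G A (c A))
    opt_measure Omega G V k w A * theta V k A (c A) l w *
    uniform_on (part G A (c A) l) B.
Proof.
move=> /[dup] /follow_stopped_part FS [Fk Ek].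
rewrite [LHS]/= -/(stopped_part Omega G V k.+1 w) FS setI0 opt_measure_set0 add0r.
rewrite (follow_cells Fk) big_seq_cond [RHS]big_seq; apply: eq_big => [A|A].
  case: (boolP (A \in run Omega G c k)) => //= Ak.
  by have [] := Ek A Ak.
by move=> /andP[Ak _]; have [_ -> _] := Ek A Ak.
Qed.

Lemma opt_measure_part k w A l : follow k.+1 w -> A \in run Omega G c k ->
  (l < nparts G A (c A))%N ->
  opt_measure Omega G V k.+1 w (part G A (c A) l) =
  opt_measure Omega G V k w A * theta V k A (c A) l w.
Proof.
move=> Fk Ak lA.
have Pk : part G A (c A) l \in run Omega G c k.+1 by apply/mem_runS; exists A, l.
(* The cell has positive measure, hence a point at which to evaluate. *)
have [x Px] : exists x, part G A (c A) l x.
  apply/set0P/eqP => P0.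
  by have := run_measure_gt0 vG c_lt Pk; rewrite P0 measure0 ltxx.
rewrite opt_measureS_follow//.
transitivity (\sum_(B <- run Omega G c k) \sum_(i < nparts G B (c B))
    opt_measure Omega G V k w B * theta V k B (c B) i w * \1_(part G B (c B) i) x).
  rewrite big_seq [RHS]big_seq; apply: eq_bigr => B Bk.
  apply: eq_bigr => i _; congr (_ * _); apply: (@uniform_on_run k.+1) => //.
  by apply/mem_runS; exists B, i; split.
rewrite (step_parts vG c_lt k
  (fun B i => opt_measure Omega G V k w B * theta V k B (c B) i w)).
rewrite (step_cell vG c_lt _ Ak (run_part_sub vG c_lt Ak lA Px)).
exact: (sum_part vG c_lt
  (fun i => opt_measure Omega G V k w A * theta V k A (c A) i w) Ak lA Px).
Qed.

Lemma opt_measure_run k w B : follow k w -> opt_measure Omega G V k w B =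
  \sum_(A <- run Omega G c k) opt_measure Omega G V k w A * uniform_on A B.
Proof.
case: k => [_|k Fk].
  rewrite big_seq1 /= {2}/uniform_on setIid divff ?mul1r// gt_eqF// fine_gt0//.
  by rewrite finOmega andbT; have [] := vG (@region_root _ _ Omega G (fun _ _ => True)).
rewrite (big_run _ _ _ c k (fun A => opt_measure Omega G V k.+1 w A * uniform_on A B)).
rewrite opt_measureS_follow// big_seq [RHS]big_seq; apply: eq_bigr => A Ak.
by apply: eq_bigr => l _; rewrite opt_measure_part.
Qed.

Variable m : set T -> R.
Hypothesis m_Omega : m Omega = 1.
Hypothesis m_ge0 : forall k A, A \in run Omega G c k -> 0 <= m A.
Hypothesis m_part : forall k A l, A \in run Omega G c k ->
  (l < nparts G A (c A))%N -> m (part G A (c A) l) = m A * t A l.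
Hypothesis t_ge0 : forall k A l, A \in run Omega G c k ->
  (l < nparts G A (c A))%N -> 0 <= t A l.
Hypothesis t_sum : forall k A, A \in run Omega G c k ->
  \sum_(l < nparts G A (c A)) t A l = 1.
Hypothesis eps_ge0 : 0 <= eps.

Lemma sum_m_run k : \sum_(A <- run Omega G c k) m A = 1.
Proof.
elim: k => [|k IH]; first by rewrite big_seq1.
rewrite (big_run _ _ _ c k m) -IH big_seq [RHS]big_seq; apply: eq_bigr => A Ak.
rewrite (eq_bigr (fun l : 'I__ => m A * t A l)).
  by rewrite -mulr_sumr (t_sum Ak) mulr1.
by move=> l _; exact: m_part Ak _.
Qed.

(* The error on the masses of the cells is multiplicative because a split of a
   cell with the wrong mass M perturbs its parts by at most M * eps in total. *)
Lemma opt_measure_error k w : follow k w ->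
  1 + \sum_(A <- run Omega G c k) `|opt_measure Omega G V k w A - m A|
  <= (1 + eps) ^+ k.
Proof.
elim: k => [_|k IH Fk].
  rewrite big_seq1 /= m_Omega /uniform_on setIid divff ?subrr ?normr0 ?addr0//.
  rewrite gt_eqF// fine_gt0// finOmega andbT.
  by have [] := vG (@region_root _ _ Omega G (fun _ _ => True)).
have [Fk' Ek] := Fk.
set e := \sum_(A <- run Omega G c k) `|opt_measure Omega G V k w A - m A| in IH *.
apply: (@le_trans _ _ ((1 + e) * (1 + eps))); last first.
  by rewrite exprSr ler_wpM2r ?IH// addr_ge0.
rewrite (big_run _ _ _ c k (fun A => `|opt_measure Omega G V k.+1 w A - m A|)).
apply: (@le_trans _ _ (1 + \sum_(A <- run Omega G c k)
    ((m A + `|opt_measure Omega G V k w A - m A|) * eps +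
     `|opt_measure Omega G V k w A - m A|))).
  rewrite lerD2l big_seq [leRHS]big_seq; apply: ler_sum => A Ak.
  set M := opt_measure Omega G V k w A.
  have hM : `|M| <= m A + `|M - m A|.
    have := ler_normD (m A) (M - m A).
    by rewrite (ger0_norm (m_ge0 Ak)) (_ : m A + (M - m A) = M)//; ring.
  (* Here M theta - m t = M (theta - t) + (M - m) t, and the weights [t] sum to 1. Summed over the
     cells, the new error is at most (1 + e) eps + e. *)
  apply: (@le_trans _ _ (\sum_(l < nparts G A (c A))
      (`|M| * `|theta V k A (c A) l w - t A l| + `|M - m A| * t A l))).
    apply: ler_sum => l _; rewrite opt_measure_part// (m_part Ak)//.
    rewrite -/M (_ : _ - _ = M * (theta V k A (c A) l w - t A l) + (M - m A) * t A l).
      apply: le_trans (ler_normD _ _) _.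
      by rewrite !normrM (ger0_norm (t_ge0 Ak (ltn_ord l))).
    by ring.
  rewrite big_split/= -!mulr_sumr (t_sum Ak) mulr1 lerD2r.
  apply: le_trans (ler_wpM2r eps_ge0 hM).
  rewrite ler_wpM2l// ltW//.
  have [_ _] := Ek A Ak; rewrite /near_target/=.
  by under eq_bigr do rewrite tnth_mktuple.
rewrite big_split/= -mulr_suml big_split/= sum_m_run -/e; lra.
Qed.

(** Once every cell has stopped, no cell is left to contribute, and each later step only intersects
    the argument with the stopped part, now [Omega]. *)
Lemma opt_measure_stop n w k B : (follow n `&` step_event n true) w -> (n < k)%N ->
  [/\ cells Omega G V k w = [::], stopped_part Omega G V k w = Omega &
   opt_measure Omega G V k w B = opt_measure Omega G V n w (B `&` Omega)].
Proof.
move=> [Fn En]; elim: k B => [//|k IH] B; rewrite ltnS leq_eqVlt.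
have En' A : A \in run Omega G c n -> stop V n A w by move=> /En.
move=> /predU1P[<-|/IH {}IH].
  have c0 : [seq A <- cells Omega G V n w | ~~ stop V n A w] = [::].
    rewrite (follow_cells Fn); apply/eqP; rewrite -size_eq0 size_filter.
    rewrite -leqn0 leqNgt -has_count; apply/hasPn => A /En'.
    by rewrite negbK.
  have sO : stopped_part Omega G V n.+1 w = Omega.
    rewrite /= (follow_stopped_part Fn) set0U -[RHS](run_cover vG c_lt n).
    apply: eq_bigcup => //; rewrite (follow_cells Fn).
    by split=> A /=; [case|split=> //; exact: En'].
  split; [by rewrite /= c0|exact: sO|].
  by rewrite [LHS]/= -/(stopped_part Omega G V n.+1 w) sO -big_filter c0 big_nil addr0.
have [c0 s0 _] := IH B.
have sO : stopped_part Omega G V k.+1 w = Omega.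
  rewrite /= c0 s0 [\bigcup_(A in _) _](_ : _ = set0) ?setU0//.
  by apply/seteqP; split=> // x [A []].
split; [by rewrite /= c0|exact: sO|].
rewrite [LHS]/= -/(stopped_part Omega G V k.+1 w) sO c0 big_nil addr0.
by have [_ _ ->] := IH (B `&` Omega); rewrite -setIA setIid.
Qed.

(** The distance at [B] is constant in [k] beyond [n] and bounded by suprema tending to 0, so it is
    0. *)
Lemma cvg_in_variation_stop n w (nu : set T -> \bar R) B :
  (follow n `&` step_event n true) w -> cvg_in_variation Omega G V w nu ->
  measurable B -> nu B = (opt_measure Omega G V n w (B `&` Omega))%:E.
Proof.
move=> Fw cvgQ mB.
pose D k := ereal_sup [set `|(opt_measure Omega G V k w C)%:E - nu C|%E | C in measurable].
have DB : (`|(opt_measure Omega G V n w (B `&` Omega))%:E - nu B| <= 0)%E.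
  apply: (@cvge_ge _ \oo _ _ D) => //.
  exists n.+1 => // k nk; apply: ereal_sup_ubound; exists B => //.
  by have [_ _ ->] := opt_measure_stop B Fw nk.
have : (`|(opt_measure Omega G V n w (B `&` Omega))%:E - nu B| = 0)%E.
  by apply/eqP; rewrite eq_le DB abse_ge0.
move=> /eqP; rewrite abse_eq0; case: (nu B) => [r| |]//.
by rewrite -EFinB eqe subr_eq0 => /eqP ->.
Qed.

End opt_measure_follow.
(** By convexity (1 + e)^m lies on [0, 1] below its chord 1 + (2^m - 1) e, whence the choice of [e]
    as a multiple of 2^-n. *)
Lemma expr_near1 (R : realType) n (y : R) : 0 < y ->
  exists2 e : R, 0 < e & (1 + e) ^+ n < 1 + y.
Proof.
move=> y0; have bound m (e : R) : 0 < e <= 1 -> (1 + e) ^+ m <= 1 + (2 ^+ m - 1) * e.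
  move=> /andP[e0 e1]; elim: m => [|m IH]; first by rewrite !expr0 subrr mul0r addr0.
  rewrite exprSr; apply: le_trans (ler_wpM2r _ IH) _; first by rewrite addr_ge0// ltW.
  rewrite exprSr; set u : R := 2 ^+ m.
  have u1 : 1 <= u by rewrite exprn_ege1// ler1n.
  have : (u - 1) * e * e <= (u - 1) * e by rewrite ler_piMr// mulr_ge0 ?subr_ge0 ?(ltW e0).
  by move=> h; lra.
pose e := Num.min 1 (y / 2 ^+ n).
have e0 : 0 < e by rewrite lt_min ltr01 divr_gt0// exprn_gt0.
have e1 : e <= 1 by rewrite ge_min lexx.
exists e => //; apply: le_lt_trans (bound n e _) _; first by rewrite e0.
rewrite ltrD2l; apply: (@lt_le_trans _ _ (2 ^+ n * e)).
  by rewrite ltr_pM2r// ltrBlDr ltrDl.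
by rewrite mulrC -ler_pdivlMr ?exprn_gt0// ge_min lexx orbT.
Qed.

Lemma L1_dist_sym d (T : measurableType d) (R : realType)
    (mu : {measure set T -> \bar R}) (D : set T) (f g : T -> R) :
  L1_dist mu D f g = L1_dist mu D g f.
Proof. by apply: eq_integral => x _; rewrite distrC. Qed.

(** * Integrals of step functions and masses of cells under a density *)

Section run_integral.
Context (R : realType) (p : nat).
Notation T := (p.-tuple R).
Notation mu := (lebesgue R p).
Variables (Omega : set T) (G : scheme R T).
Hypothesis vG : valid_scheme Omega G.
Hypothesis finOmega : (mu Omega < +oo)%E.
Variable c : set T -> nat.
Hypothesis c_lt : forall k A, elementary Omega G k A -> (c A < nways G A)%N.

Lemma integral_step k b (E : set T) : measurable E -> E `<=` Omega ->
  (\int[mu]_(x in E) (step Omega G c k b x)%:E =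
   (\sum_(A <- run Omega G c k) b A * fine (mu (A `&` E)))%:E)%E.
Proof.
move=> mE EO; have mO := measurable_Omega vG.
have ms : measurable_fun setT (step Omega G c k b) := measurable_step vG c_lt k b.
rewrite -{1}(setIidr EO) integral_mkcondr restrict_EFin.
rewrite (integral_run vG c_lt k); last first.
  apply: measurable_funTS; apply/(measurable_restrictT _ _).1 => //.
  exact: measurable_funTS.
rewrite -sumEFin big_seq [RHS]big_seq; apply: eq_bigr => A Ak.
have mA := run_measurable vG c_lt Ak.
transitivity (\int[mu]_(x in A `&` E) (cst (b A)%:E) x)%E.
  rewrite [RHS]integral_mkcondr; apply: eq_integral => x; rewrite inE => Ax.
  by rewrite !patchE; case: ifP => // _; rewrite (step_cell vG c_lt b Ak Ax).
rewrite integral_cst; last exact: measurableI.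
rewrite EFinM fineK// ge0_fin_numE//.
apply: le_lt_trans finOmega; apply: le_measure; rewrite ?inE//.
  exact: measurableI.
by move=> x [_]; exact: EO.
Qed.

Section density.
Variable f : T -> R.
Hypothesis mf : measurable_fun Omega f.
Hypothesis f_gt0 : forall x, Omega x -> 0 < f x.
Hypothesis f1 : (\int[mu]_(x in Omega) (f x)%:E = 1)%E.

Definition mass (A : set T) : R := fine (\int[mu]_(x in A) (f x)%:E).

Lemma mass_Omega : mass Omega = 1.
Proof. by rewrite /mass f1. Qed.

Lemma massE k A : A \in run Omega G c k ->
  (\int[mu]_(x in A) (f x)%:E)%E = (mass A)%:E.
Proof.
move=> Ak; rewrite fineK// ge0_fin_numE; last first.
  apply: integral_ge0 => x Ax; rewrite lee_fin ltW// f_gt0//.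
  exact: (run_sub vG c_lt Ak).
apply: (@le_lt_trans _ _ 1%E); last exact: ltry.
rewrite -f1; apply: ge0_subset_integral.
- exact: (run_measurable vG c_lt Ak).
- exact: measurable_Omega vG.
- exact/measurable_EFinP.
- by move=> x Ox; rewrite lee_fin ltW// f_gt0.
- exact: (run_sub vG c_lt Ak).
Qed.

(** Positivity of [f] enters here: it makes the ratios of masses an interior point of the
    simplex. *)
Lemma mass_gt0 k A : A \in run Omega G c k -> 0 < mass A.
Proof.
move=> Ak; rewrite -lte_fin -(massE Ak).
have AO := run_sub vG c_lt Ak.
apply: integral_gt0.
- exact: (run_measurable vG c_lt Ak).
- apply/measurable_EFinP; apply: measurable_funS AO mf.
  exact: measurable_Omega vG.
- by move=> x Ax; rewrite lte_fin f_gt0//; exact: AO.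
- exact: (run_measure_gt0 vG c_lt Ak).
Qed.

Lemma mass_sum k A : A \in run Omega G c k ->
  \sum_(l < nparts G A (c A)) mass (part G A (c A) l) = mass A.
Proof.
move=> Ak; apply: EFin_inj; rewrite -(massE Ak) (integral_run_part vG c_lt mf Ak).
rewrite -sumEFin; apply: eq_bigr => l _; rewrite (@massE k.+1)//.
by apply/mem_runS; exists A, l; split.
Qed.

End density.
End run_integral.

(** * The L1 ball around a positive density *)

Section optional_polya_tree.
Context (R : realType) (p : nat) (I : 'I_p -> interval R).
Notation T := (p.-tuple R).
Notation mu := (lebesgue R p).
Local Notation Omega := (rectangle I).
Context (G : scheme R T) d (Xi : measurableType d) (P : probability Xi R).
Context (V : draws P T) (delta eta : R).
Context (Q : Xi -> probability T R) (q : Xi -> T -> R).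
Hypothesis finOmega : (mu Omega < +oo)%E.
Hypothesis vG : valid_scheme Omega G.
Hypothesis gG : generates_open_sets Omega G.
Hypothesis procV : optional_stopping_process Omega G V.
Hypothesis delta0 : 0 < delta.
Hypothesis rho_delta : {ae P, forall w, forall k A, active Omega G V k A w ->
  delta < rho V k A w < 1 - delta}.
Hypothesis eta0 : 0 < eta.
Hypothesis bG : bounded_away Omega G eta.
Hypothesis cvgQ : {ae P, forall w, cvg_in_variation Omega G V w (Q w)}.
Hypothesis densQ : {ae P, forall w, density_of Omega (Q w) (q w)}.

Let mOmega : measurable (Omega : set T) := measurable_rectangle I.

(** On this event the limit is the measure of stage [n], which has a step density; two integrable
    densities with equal integrals over all measurable subsets agree almost everywhere. *)
Lemma density_stop c t eps n w :
  (forall k A, elementary Omega G k A -> (c A < nways G A)%N) ->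
  (follow Omega G V c t eps n `&` step_event Omega G V c t eps n true) w ->
  cvg_in_variation Omega G V w (Q w) -> density_of Omega (Q w) (q w) ->
  ae_eq mu Omega (EFin \o q w) (EFin \o step Omega G c n
    (fun A => opt_measure Omega G V n w A / fine (mu A))).
Proof.
move=> c_lt Fw cw [mq q0 Qq].
have ms := measurable_step_Omega vG c_lt n
  (fun A => opt_measure Omega G V n w A / fine (mu A)).
apply: integral_ae_eq => //.
- apply/integrableP; split; first exact/measurable_EFinP.
  apply: (@le_lt_trans _ _ (Q w setT)); last by rewrite probability_setT ltry.
  rewrite (Qq _ measurableT) setTI le_eqVlt; apply/orP; left; apply/eqP.
  by apply: eq_integral => x /[!inE] Ox; rewrite /= ger0_norm// q0.
- exact/measurable_EFinP.
move=> E EO mE; rewrite [RHS](integral_step vG finOmega c_lt n _ mE EO).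
have := Qq E mE; rewrite (setIidl EO) => <-.
rewrite (cvg_in_variation_stop vG c_lt Fw cw mE) (setIidl EO).
rewrite (opt_measure_run vG finOmega c_lt E (proj1 Fw)).
congr (_%:E); apply: eq_bigr => A _.
by rewrite /uniform_on mulrA mulrAC.
Qed.

Lemma positive_density_ball (f : T -> R) (tau : R) : measurable_fun Omega f ->
  (forall x, Omega x -> 0 < f x) -> (\int[mu]_(x in Omega) (f x)%:E = 1)%E ->
  0 < tau -> exists E, [/\ measurable E, (0 < P E)%E & forall w, E w ->
    measurable_fun Omega (q w) /\ (L1_dist mu Omega (q w) f < tau%:E)%E].
Proof.
move=> mf f0 f1 tau0.
have fi : mu.-integrable Omega (EFin \o f).
  apply/integrableP; split; first exact/measurable_EFinP.
  rewrite (_ : (\int[mu]_(x in Omega) _ = 1)%E) ?ltry// -f1.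
  by apply: eq_integral => x /[!inE] Ox; rewrite /= gtr0_norm// f0.
have tau20 : 0 < tau / 2 by rewrite divr_gt0.
have [c [n [c_lt fn]]] := run_average_dense finOmega vG gG fi tau20.
(* With this tolerance the error accumulated over the [n] splits stays below [tau / 2]. *)
have [eps eps0 eps_lt] := expr_near1 n tau20.
pose m := mass f; pose t A l := m (part G A (c A) l) / m A.
have m_gt0 k A : A \in run Omega G c k -> 0 < m A.
  by move=> Ak; exact: (mass_gt0 vG c_lt mf f0 f1 Ak).
have t_gt0 k A l : A \in run Omega G c k -> (l < nparts G A (c A))%N -> 0 < t A l.
  move=> Ak lA; rewrite divr_gt0//; [apply: (m_gt0 k.+1)|exact: (m_gt0 k)].
  by apply/mem_runS; exists A, l; split.
have t_sum k A : A \in run Omega G c k -> \sum_(l < nparts G A (c A)) t A l = 1.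
  move=> Ak; rewrite -mulr_suml (mass_sum vG c_lt mf f0 f1 Ak) divff// gt_eqF//.
  exact: (m_gt0 k).
have sel k A : elementary Omega G k A -> 0 < selection G A (c A).
  move=> Ak; have [/andP[h _] _] := bG Ak (c_lt _ _ Ak).
  exact: lt_le_trans h.
pose F := follow Omega G V c t eps n `&` step_event Omega G V c t eps n true.
have mF : measurable F.
  by apply: measurableI; [exact: measurable_follow|exact: measurable_step_event].
have F0 : (0 < P F)%E.
  by exact: (follow_stop_gt0 vG c_lt procV delta0 rho_delta sel eps0 t_gt0 t_sum n).
have [N1 [mN1 N10 HN1]] := cvgQ; have [N2 [mN2 N20 HN2]] := densQ.
exists (F `\` (N1 `|` N2)); split.
- by apply: measurableD => //; exact: measurableU.
- apply: (lt_le_trans F0); apply: measure_setD_null => //; first exact: measurableU.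
  by rewrite measureU0.
move=> w [Fw /not_orP[N1w N2w]].
have cw : cvg_in_variation Omega G V w (Q w) by apply: contrapT => /HN1.
have dw : density_of Omega (Q w) (q w) by apply: contrapT => /HN2.
have [mq _ _] := dw; split => //.
pose bM A := opt_measure Omega G V n w A / fine (mu A).
pose bm A := m A / fine (mu A).
have msM := measurable_step_Omega vG c_lt n bM.
have msm := measurable_step_Omega vG c_lt n bm.
have -> : L1_dist mu Omega (q w) f = L1_dist mu Omega (step Omega G c n bM) f.
  apply: ae_eq_integral => //.
  - by apply/measurable_EFinP; apply: measurableT_comp => //; exact: measurable_funB.
  - by apply/measurable_EFinP; apply: measurableT_comp => //; exact: measurable_funB.
  have := density_stop c_lt Fw cw dw; apply: filterS => x h Ox.
  by have := h Ox; rewrite /= => -[->].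
apply: le_lt_trans (L1_dist_triangle mu mOmega msM msm mf) _.
rewrite [tau]splitr EFinD lteD//; last by rewrite L1_dist_sym.
rewrite (L1_dist_step vG finOmega c_lt) lte_fin.
(* Integrating over a cell cancels the division by [mu A], so the distance is the sum of the errors
   on masses; adding 1 gives the form of [opt_measure_error]. *)
rewrite -(ltrD2l 1); apply: le_lt_trans eps_lt.
apply: le_trans (opt_measure_error vG finOmega c_lt (mass_Omega f1) _ _ _ _ _ (proj1 Fw)).
- rewrite lerD2l big_seq [leRHS]big_seq; apply: ler_sum => A Ak.
  have muA : 0 < fine (mu A).
    rewrite fine_gt0// (run_measure_gt0 vG c_lt Ak) -ge0_fin_numE//.
    exact: (run_fin_num vG finOmega c_lt Ak).
  by rewrite -mulrBl normrM normfV (gtr0_norm muA) divfK// gt_eqF.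
- by move=> k A Ak; exact/ltW/(m_gt0 k).
- move=> k A l Ak lA; rewrite /t mulrC divfK// gt_eqF//; exact: (m_gt0 k).
- by move=> k A l Ak lA; exact/ltW/(t_gt0 k).
- exact: t_sum.
- exact: ltW.
Qed.

End optional_polya_tree.
(** For g = (1 - s) f + s u with [u] the uniform density, g - f = s (u - f) has L1 norm at most 2
    s. *)
Lemma exists_positive_density d (T : measurableType d) (R : realType)
    (mu : {measure set T -> \bar R}) (D : set T) (f : T -> R) (eps : R) :
  measurable D -> (0 < mu D < +oo)%E -> measurable_fun D f ->
  (forall x, D x -> 0 <= f x) -> (\int[mu]_(x in D) (f x)%:E = 1)%E -> 0 < eps ->
  exists g : T -> R, [/\ measurable_fun D g, forall x, D x -> 0 < g x,
    (\int[mu]_(x in D) (g x)%:E = 1)%E & (L1_dist mu D g f < eps%:E)%E].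
Proof.
move=> mD /andP[D0 Doo] mf f0 f1 eps0.
set v := fine (mu D); have vE : mu D = v%:E by rewrite fineK// ge0_fin_numE.
have v0 : 0 < v by rewrite fine_gt0// D0.
(* The bound 1/2 keeps the weight of [f] positive, and eps / 4 makes 2 s < eps. *)
pose s := Num.min (2^-1) (eps / 4).
have s0 : 0 < s by rewrite lt_min invr_gt0 ltr0n divr_gt0.
have s1 : s < 1 by rewrite gt_min; apply/orP; left; lra.
have s2 : s *+ 2 < eps.
  have : s <= eps / 4 by rewrite ge_min lexx orbT.
  by rewrite -mulr_natr; lra.
pose u : T -> R := cst v^-1.
have mu_ : measurable_fun D u by exact: measurable_cst.
have u1 : (\int[mu]_(x in D) (u x)%:E = 1)%E.
  transitivity (\int[mu]_(x in D) (cst (v^-1)%:E) x)%E => //.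
  by rewrite integral_cst// vE -EFinM mulVf// gt_eqF.
exists (fun x => (1 - s) * f x + s * u x); split.
- by apply: measurable_funD; exact: measurable_funM.
- move=> x Dx; rewrite ltr_wpDl ?mulr_ge0 ?f0//; first by rewrite subr_ge0 ltW.
  by rewrite mulr_gt0// invr_gt0.
- under eq_integral do rewrite EFinD !EFinM.
  have s10 : 0 <= 1 - s by rewrite subr_ge0 ltW.
  have u0 x : D x -> (0 <= (u x)%:E)%E by rewrite lee_fin invr_ge0 ltW.
  have f0' x : D x -> (0 <= (f x)%:E)%E by move=> Dx; rewrite lee_fin f0.
  have mf' : measurable_fun D (fun x => (f x)%:E) by exact/measurable_EFinP.
  have mu' : measurable_fun D (fun x => (u x)%:E) by exact/measurable_EFinP.
  rewrite ge0_integralD//.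
  + rewrite !ge0_integralZl// ?lee_fin ?(ltW s0)//.
    by rewrite f1 u1 !mule1 -EFinD subrK.
  + by move=> x Dx; rewrite mule_ge0 ?f0'// lee_fin.
  + by apply/measurable_EFinP; exact: measurable_funM.
  + by move=> x Dx; rewrite mule_ge0 ?u0// lee_fin ltW.
  + by apply/measurable_EFinP; exact: measurable_funM.
- have -> : L1_dist mu D (fun x => (1 - s) * f x + s * u x) f =
      L1_dist mu D (fun x => s * u x) (fun x => s * f x).
    by apply: eq_integral => x _; congr (`|_|%:E); ring.
  rewrite L1_dist_scale// (gtr0_norm s0).
  have m0 : measurable_fun D (fun=> 0 : R) by exact: measurable_cst.
  have L0 h : (forall x, D x -> 0 <= h x) -> (\int[mu]_(x in D) (h x)%:E = 1)%E ->
      L1_dist mu D h (fun=> 0) = 1%E.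
    move=> h0 <-; apply: eq_integral => x; rewrite inE => Dx.
    by rewrite subr0 ger0_norm// h0.
  apply: (@le_lt_trans _ _ (s%:E * 2%:E)%E).
    rewrite lee_wpmul2l// ?lee_fin ?(ltW s0)//.
    apply: le_trans (L1_dist_triangle mu mD mu_ m0 mf) _.
    have Lu : L1_dist mu D u (fun=> 0) = 1%E.
      by apply: L0 => // x _; rewrite invr_ge0 ltW.
    by rewrite Lu L1_dist_sym (L0 f).
  by rewrite -EFinM lte_fin mulr_natr.
Qed.

Unset Implicit Arguments.
Set Strict Implicit.
Theorem theorem2 (R : realType) (p : nat) (I : 'I_p -> interval R)
    (G : scheme R (p.-tuple R))
    (d : measure_display) (Xi : measurableType d) (P : probability Xi R)
    (V : draws P (p.-tuple R)) (delta : R)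
    (Q : Xi -> probability (p.-tuple R) R) (q : Xi -> p.-tuple R -> R)
    (f : p.-tuple R -> R) (tau : R) :
  let Omega := rectangle I in
  (forall i, bounded_set [set` I i]) ->
  valid_scheme Omega G ->
  generates_open_sets Omega G ->
  optional_stopping_process Omega G V ->
  0 < delta ->
  {ae P, forall w, forall k A, active Omega G V k A w ->
     delta < rho V k A w < 1 - delta} ->
  (exists2 eta : R, 0 < eta & bounded_away Omega G eta) ->
  {ae P, forall w, cvg_in_variation Omega G V w (Q w)} ->
  {ae P, forall w, density_of Omega (Q w) (q w)} ->
  probability_density Omega f ->
  0 < tau ->
  positive_probability P
    [set w | (\int[lebesgue R p]_(x in Omega) `|q w x - f x|%:E < tau%:E)%E].
Proof.
move=> Omega bI vG gG procV delta0 rho_delta [eta eta0 bG] cvgQ densQ [mf f0 f1] tau0.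
have finOmega := rectangle_lty bI.
have mOmega := measurable_Omega vG.
have Omega0 : (0 < lebesgue R p Omega)%E.
  by have [] := vG _ _ (@region_root _ _ Omega G (fun _ _ => True)).
have tau20 : 0 < tau / 2 by rewrite divr_gt0.
have [|g [mg g0 g1 gf]] := exists_positive_density mOmega _ mf f0 f1 tau20.
  by rewrite Omega0.
have [E [mE E0 HE]] := positive_density_ball finOmega vG gG procV delta0 rho_delta
  eta0 bG cvgQ densQ mg g0 g1 tau20.
exists E; split=> // w /HE[mq qg].
apply: le_lt_trans (L1_dist_triangle (lebesgue R p) mOmega mq mg mf) _.
by rewrite [tau]splitr EFinD lteD.
Qed.
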